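(* Let $ABC$ be a triangle and $P$ a point not on the extended sides of $ABC$ or of its anticomplementary triangle. If $P$ does not lie on a median of triangle $ABC$, the map $$\Phi_P=T_P \circ K^{-1} \circ T_{P'} \circ K^{-1}$$ takes the $9$-point conic $\mathcal{N}_H$ to the inconic $\mathcal{I}$ and fixes the point $Z$, the center of $\mathcal{C}_P$. Thus, $Z$ lies on $\mathcal{I}$, and the conics $\mathcal{N}_H$ and $\mathcal{I}$ are tangent to each other at $Z$. The same map $\Phi_P$ also takes the $9$-point conic $\mathcal{N}_{H'}$ to the inconic $\mathcal{I}'$ which is tangent to the sides of $ABC$ at $D_3, E_3, F_3$. The point $Z$ is the center of the map $\Phi_P$ (a homology or elation with axis $l_\infty$, i.e. a homothety or a translation).
   Context: We work in the Euclidean plane extended by the line at infinity $l_\infty$; affine maps act on the extended plane. Two lines are parallel if they meet $l_\infty$ in the same point (a line is parallel to itself). Products of lines such as $AP\cdot BC$ denote intersection points. The center of a conic is the pole of $l_\infty$ with respect to it (possibly infinite). The center of a homothety is its ordinary fixed point; the center of a translation is the point at infinity of its direction. $ABC$ is a triangle with centroid $G$; $D_0,E_0,F_0$ are the midpoints of $BC,CA,AB$. $K$ is the complement map, the homothety with center $G$ and ratio $-1/2$; $K^{-1}(ABC)$ is the anticomplementary triangle. $P$ is a point (ordinary or infinite) not on the extended sides of $ABC$ or $K^{-1}(ABC)$. $D=AP\cdot BC$, $E=BP\cdot CA$, $F=CP\cdot AB$ are its traces. $D_3,E_3,F_3$ are the reflections of $D,E,F$ in $D_0,E_0,F_0$;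 the lines $AD_3,BE_3,CF_3$ concur in $P'=\iota(P)$, the isotomic conjugate of $P$ (in barycentric coordinates $\iota(x:y:z)=(1/x:1/y:1/z)$). $Q=K(P')$, $Q'=K(P)$. $T_P$ and $T_{P'}$ are the unique affine maps taking $A,B,C$ to $D,E,F$ and to $D_3,E_3,F_3$, respectively. The medians are the lines $AG,BG,CG$. If $P$ is not on a median, $\mathcal{C}_P=ABCPQ$ is the unique (nondegenerate) conic through $A,B,C,P,Q$, and $Z$ is its center. The generalized orthocenter $H$ of $P$ is the point lying on the lines through $A,B,C$ parallel respectively to $QD,QE,QF$ (these are concurrent). $O=K(H)$ is the generalized circumcenter. The nine-point conic of a quadrangle with respect to $l_\infty$ is the locus of centers of the conics through its four vertices, the center of a degenerate conic (pair of opposite sides) being the intersection of its two lines; it passes through the three diagonal points and the midpoints of the six sides (if a vertex is infinite, the ''midpoint'' of a side through it is that vertex itself). $\mathcal{N}_{P'}$ is the nine-point conic of the quadrangle $ABCP'$, and $\tilde{\mathcal{C}}_O=T_{P'}^{-1}(\mathcal{N}_{P'})$, a circumconic of $ABC$ with center $O$. If $H$ is not a vertex of $ABC$, $\mathcal{N}_H$ is the nine-point conic of the quadrangle $ABCH$; if $H$ is a vertex, $\mathcal{N}_H$ is defined to be $K(\tilde{\mathcal{C}}_O)$. (One has $\mathcal{N}_H=K(\tilde{\mathcal{C}}_O)$ in all cases.) $\mathcal{I}$ is the inconic of $P$: the conic tangent to $BC,CA,AB$ at $D,E,F$; its center is $Q$. $H'$, $\mathcal{N}_{H'}$, $\mathcal{I}'$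 are the corresponding objects when $P$ is replaced by $P'$ (so $D,E,F,Q$ are replaced by $D_3,E_3,F_3,Q'$). *)

(* Defs.v *)
From mathcomp Require Import all_boot all_order all_algebra.
From mathcomp Require Import classical_sets reals.

Set Implicit Arguments.
Unset Strict Implicit.
Unset Printing Implicit Defensive.

Import GRing.Theory.
Local Open Scope classical_set_scope.
Local Open Scope ring_scope.

(* The extended plane is the real projective plane in homogeneous coordinates:
   a point is a nonzero column vector X, a line a nonzero row vector l, both up
   to a nonzero scalar, and X lies on l when l *m X = 0.  The ordinary point
   (x, y) is (x : y : 1), and the line at infinity is (0 : 0 : 1).  Projective
   maps are invertible matrices acting on columns. *)

Section ExtendedPlane.
Variable R : realType.
Implicit Types (X Y O : 'cV[R]_3) (l m : 'rV[R]_3).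

(* Equality of projective objects: points, lines, conics or maps. *)
Definition proj_eq (p q : nat) (U V : 'M[R]_(p, q)) : Prop :=
  exists2 c : R, c != 0 & U = c *: V.

Definition on_line X l : Prop := l *m X = 0.

(* Cross products; the index i : 'I_3 is taken modulo 3. *)
Definition join X Y : 'rV[R]_3 :=
  \row_(i < 3) (X (i + 1) 0 * Y (i + 2) 0 - X (i + 2) 0 * Y (i + 1) 0).
Definition meet l m : 'cV[R]_3 :=
  \col_(i < 3) (l 0 (i + 1) * m 0 (i + 2) - l 0 (i + 2) * m 0 (i + 1)).

Definition linf : 'rV[R]_3 := delta_mx 0 ord_max.

Definition ordinary X : Prop := X ord_max 0 != 0.

(* The representative (x : y : 1) of an ordinary point. *)
Definition aff X : 'cV[R]_3 := (X ord_max 0)^-1 *: X.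

Definition parallel_through X l : 'rV[R]_3 := join X (meet l linf).

Definition triangle (A B C : 'cV[R]_3) : Prop :=
  [/\ ordinary A, ordinary B, ordinary C & ~ on_line C (join A B)].

Definition on_sides (A B C : 'cV[R]_3) X : Prop :=
  [\/ on_line X (join B C), on_line X (join C A) | on_line X (join A B)].

(* The sum of affine representatives has third coordinate 2 or 3, so these are
   the affine means. *)
Definition midpoint X Y : 'cV[R]_3 := aff X + aff Y.
Definition centroid (A B C : 'cV[R]_3) : 'cV[R]_3 := aff A + aff B + aff C.

Definition on_median (A B C : 'cV[R]_3) X : Prop :=
  let G := centroid A B C in
  [\/ on_line X (join A G), on_line X (join B G) | on_line X (join C G)].

(* On affine representatives, X |-> O + k (X - O). *)
Definition homothety O (k : R) : 'M[R]_3 :=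
  k%:M + (1 - k) *: (aff O *m linf).

Definition complement (A B C : 'cV[R]_3) : 'M[R]_3 :=
  homothety (centroid A B C) (- 2^-1).

Definition reflection O : 'M[R]_3 := homothety O (-1).

(* The affine map taking the ordinary points A, B, C to D, E, F; both factors
   have affine representatives as columns, so the last row of the product is
   (0, 0, 1). *)
Definition frame (A B C : 'cV[R]_3) : 'M[R]_3 :=
  \matrix_(i < 3, j < 3) (nth 0 [:: aff A; aff B; aff C] j) i 0.
Definition affine_map (A B C D E F : 'cV[R]_3) : 'M[R]_3 :=
  frame D E F *m invmx (frame A B C).

(* A nontrivial homothety with ordinary center Z, or a nontrivial translation
   with center the point at infinity Z of its direction. *)
Definition homothety_with_center (M : 'M[R]_3) (Z : 'cV[R]_3) : Prop :=
  ordinary Z /\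
  exists k : R, [/\ k != 0, k != 1 & proj_eq M (homothety Z k)].
Definition translation_with_center (M : 'M[R]_3) (Z : 'cV[R]_3) : Prop :=
  [/\ Z != 0, on_line Z linf &
      exists2 c : R, c != 0 & proj_eq M (1%:M + c *: (Z *m linf))].

(* A conic is given by an invertible symmetric matrix M. *)
Definition conic (M : 'M[R]_3) : Prop := M^T = M /\ M \in unitmx.
Definition on_conic (M : 'M[R]_3) X : Prop := X^T *m M *m X = 0.
Definition conic_points (M : 'M[R]_3) : set 'cV[R]_3 :=
  [set X | X != 0 /\ on_conic M X].
Definition polar (M : 'M[R]_3) X : 'rV[R]_3 := X^T *m M.
Definition center (M : 'M[R]_3) X : Prop := proj_eq (polar M X) linf.

(* The tangent to a conic at one of its points is the polar of that point. *)
Definition tangent_line_at (M : 'M[R]_3) l X : Prop :=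
  on_conic M X /\ proj_eq (polar M X) l.
Definition tangent_conics_at (M N : 'M[R]_3) X : Prop :=
  [/\ on_conic M X, on_conic N X & proj_eq (polar M X) (polar N X)].

Definition inconic (A B C D E F : 'cV[R]_3) (M : 'M[R]_3) : Prop :=
  [/\ conic M, tangent_line_at M (join B C) D,
      tangent_line_at M (join C A) E & tangent_line_at M (join A B) F].

(* The nine-point conic of the quadrangle ABCV with respect to linf.  The
   degenerate conics through the vertices are the pairs of opposite sides. *)
Definition nine_point_conic (A B C V : 'cV[R]_3) : set 'cV[R]_3 :=
  [set X |
    (exists M : 'M[R]_3, [/\ conic M,
       [/\ on_conic M A, on_conic M B, on_conic M C & on_conic M V] &
       center M X])
    \/ [\/ proj_eq X (meet (join B C) (join A V)),
           proj_eq X (meet (join C A) (join B V)) |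
           proj_eq X (meet (join A B) (join C V))]].

Definition gen_orthocenter (A B C Q D E F H : 'cV[R]_3) : Prop :=
  [/\ H != 0, on_line H (parallel_through A (join Q D)),
      on_line H (parallel_through B (join Q E)) &
      on_line H (parallel_through C (join Q F))].

(* N_H for a generalized orthocenter H of P, where P' is the isotomic conjugate
   of P and T' is the affine map T_{P'}. *)
Definition nine_point_conic_H
    (A B C P' : 'cV[R]_3) (T' : 'M[R]_3) (H : 'cV[R]_3) : set 'cV[R]_3 :=
  let K := complement A B C in
  let vertex := [\/ proj_eq H A, proj_eq H B | proj_eq H C] in
  let CO := [set invmx T' *m X | X in nine_point_conic A B C P'] in
  [set X | (~ vertex /\ nine_point_conic A B C H X)
           \/ (vertex /\ [set K *m Y | Y in CO] X)].

End ExtendedPlane.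

Arguments linf {R}.

(* Main.v *)
(* In barycentric coordinates with respect to ABC, write P = (x : y : z).  Then
   P' = (yz : zx : xy), Q = (x(y+z) : y(z+x) : z(x+y)), and solving for the conic
   ABCPQ gives its center Z = (x(y-z)^2 : y(z-x)^2 : z(x-y)^2).  Multiplying out,
   (y+z)(z+x)(x+y) Phi = 8xyz + Z (1, 1, 1), where (1, 1, 1) is the line at
   infinity: so Phi is a homothety or translation with center Z, and it is
   unchanged when P and P' are exchanged.  The inconic is tangent to the sides at
   the traces of P, hence is determined up to a scalar, and passes through Z.  With
   u = xy + yz + zx - x^2 and v, w its cyclic shifts, H = (xvw : yuw : zuv); the
   nine-point conic of ABCH is then, up to the factor uvw, the pullback of the
   inconic by Phi.  When uvw = 0 the point H is a vertex, and the pullback of the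
   inconic by T_P K^-1 is the nine-point conic of ABCP'. *)
Require Import Defs.
From mathcomp Require Import all_boot all_order all_algebra.
From mathcomp Require Import boolp classical_sets reals.
From mathcomp Require Import ring.

Set Implicit Arguments.
Unset Strict Implicit.
Unset Printing Implicit Defensive.

Import GRing.Theory.
Local Open Scope classical_set_scope.
Local Open Scope ring_scope.

(** * Explicit 3-by-3 linear algebra, reducing matrix identities to polynomial ones *)

Section Coordinates.
Variable R : realType.
Implicit Types (x y z : R).

Definition col3 x y z : 'cV[R]_3 := \col_(i < 3) [:: x; y; z]`_i.
Definition row3 x y z : 'rV[R]_3 := \row_(j < 3) [:: x; y; z]`_j.
Definition mat3 a b c d e f g h k : 'M[R]_3 :=
  \matrix_(i < 3, j < 3) (nth [::] [:: [:: a; b; c]; [:: d; e; f]; [:: g; h; k]] i)`_j.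

(** The indices are written in the form that [big_ord_recl] produces, so that expanded sums match
    them syntactically. *)
Definition i0 : 'I_3 := ord0.
Definition i1 : 'I_3 := lift ord0 ord0.
Definition i2 : 'I_3 := lift ord0 (lift ord0 ord0).

Lemma ord3P (P : 'I_3 -> Prop) : P i0 -> P i1 -> P i2 -> forall i, P i.
Proof.
move=> P0 P1 P2 [[|[|[|//]]] Hi].
- by have -> : Ordinal Hi = i0 by apply: val_inj.
- by have -> : Ordinal Hi = i1 by apply: val_inj.
- by have -> : Ordinal Hi = i2 by apply: val_inj.
Qed.

Lemma sum3 (f : 'I_3 -> R) : \sum_i f i = f i0 + f i1 + f i2.
Proof. by rewrite !big_ord_recl big_ord0 addr0 addrA. Qed.

Lemma col3_eta (X : 'cV[R]_3) : X = col3 (X i0 0) (X i1 0) (X i2 0).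
Proof. by apply/matrixP => i j; rewrite ord1 !mxE; move: i; apply: ord3P. Qed.

Lemma row3_eta (X : 'rV[R]_3) : X = row3 (X 0 i0) (X 0 i1) (X 0 i2).
Proof. by apply/matrixP => i j; rewrite ord1 !mxE; move: j; apply: ord3P. Qed.

Lemma mat3_eta (M : 'M[R]_3) :
  M = mat3 (M i0 i0) (M i0 i1) (M i0 i2) (M i1 i0) (M i1 i1) (M i1 i2)
           (M i2 i0) (M i2 i1) (M i2 i2).
Proof.
by apply/matrixP; do 2 apply: ord3P; rewrite !mxE.
Qed.

Lemma col3_inj x y z x' y' z' :
  col3 x y z = col3 x' y' z' -> [/\ x = x', y = y' & z = z'].
Proof.
by move=> /matrixP e; split; [move: (e i0 0) | move: (e i1 0) | move: (e i2 0)];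
  rewrite !mxE.
Qed.

Lemma row3_inj x y z x' y' z' :
  row3 x y z = row3 x' y' z' -> [/\ x = x', y = y' & z = z'].
Proof.
by move=> /matrixP e; split; [move: (e 0 i0) | move: (e 0 i1) | move: (e 0 i2)];
  rewrite !mxE.
Qed.

Lemma tr_col3 x y z : (col3 x y z)^T = row3 x y z.
Proof. by apply/matrixP => i j; rewrite !mxE. Qed.

Lemma tr_mat3 a b c d e f g h k :
  (mat3 a b c d e f g h k)^T = mat3 a d g b e h c f k.
Proof. by apply/matrixP; do 2 apply: ord3P; rewrite !mxE. Qed.

Lemma scale_col3 t x y z : t *: col3 x y z = col3 (t * x) (t * y) (t * z).
Proof. by apply/matrixP => i j; rewrite !mxE; move: i; apply: ord3P. Qed.

Lemma scale_row3 t x y z : t *: row3 x y z = row3 (t * x) (t * y) (t * z).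
Proof. by apply/matrixP => i j; rewrite !mxE; move: j; apply: ord3P. Qed.

Lemma scale_mat3 t a b c d e f g h k : t *: mat3 a b c d e f g h k =
  mat3 (t * a) (t * b) (t * c) (t * d) (t * e) (t * f) (t * g) (t * h) (t * k).
Proof. by apply/matrixP; do 2 apply: ord3P; rewrite !mxE. Qed.

Lemma add_col3 x y z x' y' z' :
  col3 x y z + col3 x' y' z' = col3 (x + x') (y + y') (z + z').
Proof. by apply/matrixP => i j; rewrite !mxE; move: i; apply: ord3P. Qed.

Lemma add_mat3 a b c d e f g h k a' b' c' d' e' f' g' h' k' :
  mat3 a b c d e f g h k + mat3 a' b' c' d' e' f' g' h' k' =
  mat3 (a + a') (b + b') (c + c') (d + d') (e + e') (f + f')
       (g + g') (h + h') (k + k').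
Proof. by apply/matrixP; do 2 apply: ord3P; rewrite !mxE. Qed.

Lemma scalar_mat3 t : t%:M = mat3 t 0 0 0 t 0 0 0 t.
Proof. by apply/matrixP; do 2 apply: ord3P; rewrite !mxE. Qed.

Lemma mul_mat3_col3 a b c d e f g h k x y z :
  mat3 a b c d e f g h k *m col3 x y z =
  col3 (a * x + b * y + c * z) (d * x + e * y + f * z) (g * x + h * y + k * z).
Proof.
by apply/matrixP => i j; rewrite !mxE sum3 !mxE; move: i; apply: ord3P.
Qed.

Lemma mul_row3_mat3 x y z a b c d e f g h k :
  row3 x y z *m mat3 a b c d e f g h k =
  row3 (x * a + y * d + z * g) (x * b + y * e + z * h) (x * c + y * f + z * k).
Proof.
by apply/matrixP => i j; rewrite !mxE sum3 !mxE; move: j; apply: ord3P.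
Qed.

Lemma mul_row3_col3 x y z x' y' z' :
  row3 x y z *m col3 x' y' z' = (x * x' + y * y' + z * z')%:M.
Proof.
by apply/matrixP => i j; rewrite !ord1 !mxE sum3 !mxE.
Qed.

Lemma mul_col3_row3 x y z x' y' z' :
  col3 x y z *m row3 x' y' z' =
  mat3 (x * x') (x * y') (x * z') (y * x') (y * y') (y * z')
       (z * x') (z * y') (z * z').
Proof.
by apply/matrixP; do 2 apply: ord3P; rewrite !mxE big_ord1 !mxE.
Qed.

Lemma mul_mat3 a b c d e f g h k a' b' c' d' e' f' g' h' k' :
  mat3 a b c d e f g h k *m mat3 a' b' c' d' e' f' g' h' k' =
  mat3 (a * a' + b * d' + c * g') (a * b' + b * e' + c * h')
       (a * c' + b * f' + c * k')
       (d * a' + e * d' + f * g') (d * b' + e * e' + f * h')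
       (d * c' + e * f' + f * k')
       (g * a' + h * d' + k * g') (g * b' + h * e' + k * h')
       (g * c' + h * f' + k * k').
Proof.
by apply/matrixP; do 2 apply: ord3P; rewrite !mxE sum3 !mxE.
Qed.

Lemma join_col3 x y z x' y' z' :
  join (col3 x y z) (col3 x' y' z') =
  row3 (y * z' - z * y') (z * x' - x * z') (x * y' - y * x').
Proof.
by apply/matrixP => i j; rewrite ord1 !mxE; move: j; apply: ord3P.
Qed.

Lemma meet_row3 x y z x' y' z' :
  meet (row3 x y z) (row3 x' y' z') =
  col3 (y * z' - z * y') (z * x' - x * z') (x * y' - y * x').
Proof.
by apply/matrixP => i j; rewrite ord1 !mxE; move: i; apply: ord3P.
Qed.

Lemma linf_row3 : linf = row3 0 0 1 :> 'rV[R]_3.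
Proof. by apply/matrixP => i j; rewrite ord1 !mxE; move: j; apply: ord3P. Qed.

Lemma det_mat3 a b c d e f g h k : \det (mat3 a b c d e f g h k) =
  a * (e * k - f * h) - b * (d * k - f * g) + c * (d * h - e * g).
Proof.
rewrite (expand_det_row _ i0) sum3 /cofactor.
rewrite !(expand_det_row _ (0 : 'I_2)) !big_ord_recl !big_ord0 /cofactor !det_mx11.
rewrite !mxE /=. ring.
Qed.


End Coordinates.

(** * Behaviour of incidence, polars and conics under linear maps *)

Section Projective.
Variable R : realType.

Lemma proj_eq_refl p q (U : 'M[R]_(p, q)) : proj_eq U U.
Proof. by exists 1; rewrite ?oner_neq0 // scale1r. Qed.

Lemma proj_eq_sym p q (U V : 'M[R]_(p, q)) : proj_eq U V -> proj_eq V U.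
Proof.
by case=> c c0 ->; exists c^-1; rewrite ?invr_neq0 // scalerA mulVf // scale1r.
Qed.

Lemma proj_eq_trans p q (U V W : 'M[R]_(p, q)) :
  proj_eq U V -> proj_eq V W -> proj_eq U W.
Proof.
by case=> c c0 -> [d d0 ->]; exists (c * d); rewrite ?mulf_neq0 // scalerA.
Qed.

Lemma proj_eq_mull p q r (M : 'M[R]_(r, p)) (U V : 'M[R]_(p, q)) :
  proj_eq U V -> proj_eq (M *m U) (M *m V).
Proof. by case=> c c0 ->; exists c; rewrite // scalemxAr. Qed.

Lemma proj_eq_mulr p q r (M : 'M[R]_(q, r)) (U V : 'M[R]_(p, q)) :
  proj_eq U V -> proj_eq (U *m M) (V *m M).
Proof. by case=> c c0 ->; exists c; rewrite // scalemxAl. Qed.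

Lemma proj_eq_join (X X' Y Y' : 'cV[R]_3) :
  proj_eq X X' -> proj_eq Y Y' -> proj_eq (join X Y) (join X' Y').
Proof.
case=> c c0 -> [d d0 ->]; exists (c * d); rewrite ?mulf_neq0 //.
by apply/matrixP => i j; rewrite !mxE; ring.
Qed.

Lemma proj_eq_meet (l l' m m' : 'rV[R]_3) :
  proj_eq l l' -> proj_eq m m' -> proj_eq (meet l m) (meet l' m').
Proof.
case=> c c0 -> [d d0 ->]; exists (c * d); rewrite ?mulf_neq0 //.
by apply/matrixP => i j; rewrite !mxE; ring.
Qed.

(** Cross products transform by the cofactor matrix of [M], and a further product with [M] turns the
    cofactors into [\det M]. Written without an inverse, this is a polynomial identity valid for
    singular [M] as well. *)
Lemma join_mul (M : 'M[R]_3) (X Y : 'cV[R]_3) :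
  join (M *m X) (M *m Y) *m M = \det M *: join X Y.
Proof.
rewrite (mat3_eta M) (col3_eta X) (col3_eta Y) !mul_mat3_col3 !join_col3.
rewrite mul_row3_mat3 det_mat3 scale_row3; congr row3; ring.
Qed.

Lemma meet_mul (M : 'M[R]_3) (l m : 'rV[R]_3) :
  M *m meet (l *m M) (m *m M) = \det M *: meet l m.
Proof.
rewrite (mat3_eta M) (row3_eta l) (row3_eta m) !mul_row3_mat3 !meet_row3.
rewrite mul_mat3_col3 det_mat3 scale_col3; congr col3; ring.
Qed.

Lemma on_conic_congr (S M : 'M[R]_3) (X : 'cV[R]_3) :
  on_conic (S^T *m M *m S) X <-> on_conic M (S *m X).
Proof. by rewrite /on_conic trmx_mul !mulmxA. Qed.

Lemma polar_congr (S M : 'M[R]_3) (X : 'cV[R]_3) :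
  polar (S^T *m M *m S) X = polar M (S *m X) *m S.
Proof. by rewrite /polar trmx_mul !mulmxA. Qed.

Lemma conic_congr (S M : 'M[R]_3) :
  S \in unitmx -> conic M -> conic (S^T *m M *m S).
Proof.
move=> Su [sM uM]; split; first by rewrite !trmx_mul sM trmxK mulmxA.
by rewrite !unitmx_mul unitmx_tr Su uM.
Qed.

Lemma on_conic_proj (M : 'M[R]_3) (X Y : 'cV[R]_3) :
  proj_eq X Y -> on_conic M X <-> on_conic M Y.
Proof.
suff H U V : proj_eq U V -> on_conic M V -> on_conic M U.
  by move=> XY; split; apply: H => //; apply: proj_eq_sym.
case=> c _ ->; rewrite /on_conic [(c *: V)^T]linearZ /= -scalemxAr -!scalemxAl => ->.
by rewrite !scaler0.
Qed.

Lemma conic_points_scale (c : R) (M : 'M[R]_3) :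
  c != 0 -> conic_points (c *: M) = conic_points M.
Proof.
move=> c0; suff E X : on_conic (c *: M) X <-> on_conic M X.
  by apply/seteqP; split=> X [X0 /E hX].
rewrite /on_conic -scalemxAr -scalemxAl; split=> [h|->]; last exact: scaler0.
by apply: (scalerI c0); rewrite h scaler0.
Qed.

Lemma mulmx_unit_eq0 q (M : 'M[R]_3) (X : 'M[R]_(3, q)) :
  M \in unitmx -> (M *m X == 0) = (X == 0).
Proof.
move=> Mu; apply/eqP/eqP => [h|->]; last by rewrite mulmx0.
by rewrite -(mulKmx Mu X) h mulmx0.
Qed.

Lemma conic_points_image (T M : 'M[R]_3) : T \in unitmx ->
  [set T *m X | X in conic_points (T^T *m M *m T)] = conic_points M.
Proof.
move=> Tu; apply/seteqP; split => [_ [X [X0 /on_conic_congr hX] <-]|X [X0 hX]].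
  by split; rewrite // mulmx_unit_eq0.
exists (invmx T *m X); last by rewrite mulKVmx.
split; first by rewrite mulmx_unit_eq0 // unitmx_inv.
by apply/on_conic_congr; rewrite mulKVmx.
Qed.

Lemma conic_points_preimage (T M : 'M[R]_3) : T \in unitmx ->
  [set invmx T *m X | X in conic_points M] = conic_points (T^T *m M *m T).
Proof.
move=> Tu; have Tiu : invmx T \in unitmx by rewrite unitmx_inv.
rewrite -(conic_points_image (T^T *m M *m T) Tiu) trmx_inv !mulmxA.
by rewrite mulVmx ?unitmx_tr // mul1mx -mulmxA mulmxV // mulmx1.
Qed.

End Projective.

(** * Barycentric coordinates with respect to a frame [S] *)

Section Barycentric.
Variable R : realType.
Variable S : 'M[R]_3.
Hypothesis Su : S \in unitmx.

(** When the columns of [S] are the affine representatives of the vertices, [x] holds the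
    barycentric coordinates of [X]. Lines are covectors, so their coefficients transform by the
    inverse of [S]. *)
Definition pt (X x : 'cV[R]_3) : Prop := proj_eq X (S *m x).
Definition ln (l a : 'rV[R]_3) : Prop := proj_eq l (a *m invmx S).

Lemma pt_self (X : 'cV[R]_3) : pt X (invmx S *m X).
Proof. by rewrite /pt mulKVmx //; apply: proj_eq_refl. Qed.

Lemma pt_proj X x x' : pt X x -> proj_eq x x' -> pt X x'.
Proof. by move=> h /(proj_eq_mull S); apply: proj_eq_trans. Qed.

Lemma pt_proj_eq X Y x y : pt X x -> pt Y y -> proj_eq X Y <-> proj_eq x y.
Proof.
move=> hX hY; split=> h.
  have /(proj_eq_mull (invmx S)) : proj_eq (S *m x) (S *m y).
    by apply: proj_eq_trans (proj_eq_sym hX) _; apply: proj_eq_trans h hY.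
  by rewrite !mulKmx.
by apply: proj_eq_trans hX _; apply: proj_eq_sym; apply: pt_proj hY (proj_eq_sym h).
Qed.

Lemma ln_proj_eq l m a b : ln l a -> ln m b -> proj_eq l m <-> proj_eq a b.
Proof.
move=> hl hm; split=> h.
  have /(proj_eq_mulr S) : proj_eq (a *m invmx S) (b *m invmx S).
    by apply: proj_eq_trans (proj_eq_sym hl) _; apply: proj_eq_trans h hm.
  by rewrite !mulmxKV.
apply: proj_eq_trans hl _; apply: proj_eq_sym.
by apply: proj_eq_trans hm _; apply: proj_eq_mulr; apply: proj_eq_sym.
Qed.

Lemma ln_join X Y x y : pt X x -> pt Y y -> ln (join X Y) (join x y).
Proof.
move=> hX hY; apply: proj_eq_trans (proj_eq_join hX hY) _; exists (\det S).
  by rewrite -unitfE -unitmxE.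
by rewrite -[LHS](mulmxK Su) join_mul scalemxAl.
Qed.

Lemma pt_meet l m a b : ln l a -> ln m b -> pt (meet l m) (meet a b).
Proof.
move=> hl hm; apply: proj_eq_trans (proj_eq_meet hl hm) _.
exists (\det (invmx S)); first by rewrite -unitfE -unitmxE unitmx_inv.
by rewrite -[LHS](mulKVmx Su) meet_mul scalemxAr.
Qed.

Lemma on_line_bary X l x a : pt X x -> ln l a -> on_line X l <-> a *m x = 0.
Proof.
move=> [c c0 ->] [d d0 ->]; rewrite /on_line -scalemxAl -scalemxAr mulmxA mulmxKV //.
by rewrite scalerA; split=> [/eqP|->]; rewrite ?scaler0 // scaler_eq0 mulf_eq0
  (negbTE c0) (negbTE d0) => /eqP.
Qed.

Lemma pt_neq0 X x : pt X x -> (X != 0) = (x != 0).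
Proof. by case=> c c0 ->; rewrite scaler_eq0 (negbTE c0) mulmx_unit_eq0. Qed.

Lemma pt_mul X x M m : pt X x -> M = S *m m *m invmx S -> pt (M *m X) (m *m x).
Proof.
move=> hX ->; rewrite /pt.
have -> : S *m (m *m x) = S *m m *m invmx S *m (S *m x) by rewrite !mulmxA mulmxKV.
exact: proj_eq_mull.
Qed.

Lemma polar_bary M X x :
  pt X x -> ln (polar M X) (polar (S^T *m M *m S) x).
Proof.
case=> c c0 ->; exists c => //.
by rewrite polar_congr mulmxK // /polar [(c *: _)^T]linearZ /= -scalemxAl.
Qed.

Lemma on_conic_bary M X x :
  pt X x -> on_conic M X <-> on_conic (S^T *m M *m S) x.
Proof. by move=> /on_conic_proj ->; rewrite on_conic_congr. Qed.

(** This normalization gives each column of [S] last coordinate 1, so that the line at infinity has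
    the barycentric equation x + y + z = 0. *)
Hypothesis linfS : linf *m S = row3 1 1 1.

Lemma ln_linf : ln linf (row3 1 1 1).
Proof. by rewrite /ln -linfS mulmxK //; apply: proj_eq_refl. Qed.

Lemma linf_coord (X : 'cV[R]_3) : X ord_max 0 = (linf *m X) 0 0.
Proof.
by rewrite linf_row3 !mxE sum3 !mxE /= !mul0r !add0r mul1r; congr (X _ _); apply: val_inj.
Qed.

Lemma last_coord c x y z :
  (c *: (S *m col3 x y z)) ord_max 0 = c * (x + y + z).
Proof.
by rewrite linf_coord -scalemxAr mulmxA linfS mul_row3_col3 !mxE eqxx !mul1r mulr1n.
Qed.

(** The formula stays correct at an infinite point: there x + y + z = 0, the inverse of 0 is 0, and
    both sides vanish. *)
Lemma aff_bary X x y z : pt X (col3 x y z) ->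
  aff X = S *m col3 (x / (x + y + z)) (y / (x + y + z)) (z / (x + y + z)).
Proof.
case=> c c0 e; rewrite /aff {1}e last_coord e scalerA invfM.
rewrite mulrAC mulVf // mul1r scalemxAr scale_col3.
by congr (_ *m col3 _ _ _); rewrite mulrC.
Qed.

Lemma homothety_bary X x y z k : pt X (col3 x y z) ->
  let s := (1 - k) / (x + y + z) in
  homothety X k = S *m mat3 (k + s * x) (s * x) (s * x)
                            (s * y) (k + s * y) (s * y)
                            (s * z) (s * z) (k + s * z) *m invmx S.
Proof.
move=> hX s; rewrite /homothety (aff_bary hX).
set t := x + y + z in s *.
have -> : k%:M = S *m k%:M *m invmx S by rewrite mul_mx_scalar -scalemxAl mulmxV // scalemx1.
have -> : linf = row3 1 1 1 *m invmx S by rewrite -linfS mulmxK.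
rewrite -2!mulmxA (mulmxA (col3 _ _ _)) mul_col3_row3 (mulmxA S (mat3 _ _ _ _ _ _ _ _ _)).
rewrite scalemxAl scalemxAr scale_mat3 mulmxA -mulmxDl -mulmxDr scalar_mat3 add_mat3.
by congr (_ *m _ *m _); rewrite /s; congr mat3; ring.
Qed.

Lemma frame_bary D E F x1 y1 z1 x2 y2 z2 x3 y3 z3 :
  aff D = S *m col3 x1 y1 z1 -> aff E = S *m col3 x2 y2 z2 ->
  aff F = S *m col3 x3 y3 z3 ->
  frame D E F = S *m mat3 x1 x2 x3 y1 y2 y3 z1 z2 z3.
Proof.
move=> dD dE dF; apply/matrixP => i; apply: ord3P;
  by rewrite mxE /= ?dD ?dE ?dF !mxE !sum3 !mxE.
Qed.

End Barycentric.

(** * The nine-point conic as the zero set of an explicit quadratic form *)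

Section NinePoint.
Variable R : realType.
Implicit Types (x y z p q r v : R).

(** Matrix of twice the form p yz + q zx + r xy, which vanishes at the three vertices. *)
Definition circumconic p q r : 'M[R]_3 := mat3 0 r q r 0 p q p 0.

Lemma neq0_2 : (2 : R) != 0.
Proof. by rewrite Num.Theory.pnatr_eq0. Qed.

Lemma scalar_mx11_eq0 (c : R) : (c%:M : 'M[R]_1) = 0 <-> c = 0.
Proof.
split=> [/matrixP /(_ 0 0)|->]; last by apply/matrixP => i j; rewrite !mxE mul0rn.
by rewrite !mxE eqxx mulr1n.
Qed.

Lemma on_conic_mat3 a b c d e f x y z :
  on_conic (mat3 a f e f b d e d c) (col3 x y z) <->
  a * x ^+ 2 + b * y ^+ 2 + c * z ^+ 2
  + 2 * (d * y * z + e * z * x + f * x * y) = 0 :> R.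
Proof.
rewrite /on_conic tr_col3 mul_row3_mat3 mul_row3_col3 scalar_mx11_eq0.
by split=> <-; ring.
Qed.

Lemma on_circumconic p q r x y z :
  on_conic (circumconic p q r) (col3 x y z) <->
  p * y * z + q * z * x + r * x * y = 0.
Proof.
rewrite on_conic_mat3; split=> h; last by rewrite h; ring.
by apply: (mulfI neq0_2); rewrite mulr0 -[RHS]h; ring.
Qed.

(** Vanishing at the vertices kills the diagonal of [M], and the determinant of the remaining matrix
    is 2pqr. *)
Lemma circumconicP (M : 'M[R]_3) : conic M ->
  on_conic M (col3 1 0 0) -> on_conic M (col3 0 1 0) -> on_conic M (col3 0 0 1) ->
  exists p q r, p * q * r != 0 /\ M = circumconic p q r.
Proof.
move=> [sM uM]; have := mat3_eta M.
have -> : M i1 i0 = M i0 i1 by rewrite -{1}sM mxE.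
have -> : M i2 i0 = M i0 i2 by rewrite -{1}sM mxE.
have -> : M i2 i1 = M i1 i2 by rewrite -{1}sM mxE.
move: (M i0 i0) (M i1 i1) (M i2 i2) (M i1 i2) (M i0 i2) (M i0 i1) uM.
move=> a b c p q r + eM; rewrite eM {sM M eM} => uM.
move=> /on_conic_mat3 h0 /on_conic_mat3 h1 /on_conic_mat3 h2.
have ea : a = 0 by rewrite -[RHS]h0; ring.
have eb : b = 0 by rewrite -[RHS]h1; ring.
have ec : c = 0 by rewrite -[RHS]h2; ring.
subst; exists p, q, r; split=> //; move: uM; rewrite unitmxE unitfE det_mat3.
apply: contraNneq => e; apply/eqP.
by transitivity (2 * (p * q * r)); [ring | rewrite e mulr0].
Qed.

Lemma circumconic_conic p q r : p * q * r != 0 -> conic (circumconic p q r).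
Proof.
move=> h; split; first by rewrite tr_mat3.
rewrite unitmxE unitfE det_mat3.
have -> : 0 * (0 * 0 - p * p) - r * (r * 0 - p * q) + q * (r * p - 0 * q)
  = 2 * (p * q * r) by ring.
by rewrite mulf_neq0 // neq0_2.
Qed.

(** Equation of the conic through the midpoints of the sides and the traces of v; [nine_point_mx]
    represents twice this form, which avoids halves. *)
Definition nine_point_form v1 v2 v3 x1 x2 x3 :=
  v2 * v3 * x1 ^+ 2 + v3 * v1 * x2 ^+ 2 + v1 * v2 * x3 ^+ 2
  - v1 * (v2 + v3) * x2 * x3 - v2 * (v3 + v1) * x3 * x1 - v3 * (v1 + v2) * x1 * x2.

Definition nine_point_mx v1 v2 v3 : 'M[R]_3 :=
  mat3 (2 * v2 * v3) (- (v3 * (v1 + v2))) (- (v2 * (v3 + v1)))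
       (- (v3 * (v1 + v2))) (2 * v3 * v1) (- (v1 * (v2 + v3)))
       (- (v2 * (v3 + v1))) (- (v1 * (v2 + v3))) (2 * v1 * v2).

Lemma on_nine_point_mx v1 v2 v3 x1 x2 x3 :
  on_conic (nine_point_mx v1 v2 v3) (col3 x1 x2 x3) <->
  nine_point_form v1 v2 v3 x1 x2 x3 = 0.
Proof.
rewrite on_conic_mat3 /nine_point_form; split=> h.
  by apply: (mulfI neq0_2); rewrite mulr0 -[RHS]h; ring.
by rewrite -[RHS](mulr0 2) -h; ring.
Qed.

(* The circumconic of parameters (p, q, r) passes through v and has center x. *)
Definition centered v1 v2 v3 x1 x2 x3 : Prop :=
  exists p q r c : R, [/\ p * q * r != 0, c != 0,
    p * v2 * v3 + q * v3 * v1 + r * v1 * v2 = 0 &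
    [/\ r * x2 + q * x3 = c, p * x3 + r * x1 = c & q * x1 + p * x2 = c]].

Lemma centered_cyc v1 v2 v3 x1 x2 x3 :
  centered v2 v3 v1 x2 x3 x1 -> centered v1 v2 v3 x1 x2 x3.
Proof.
move=> [p [q [r [c [h c0 hv [h1 h2 h3]]]]]]; exists r, p, q, c.
split=> //; first by rewrite -mulrA mulrC.
by rewrite -[RHS]hv; ring.
Qed.

Lemma nine_point_form_cyc v1 v2 v3 x1 x2 x3 :
  nine_point_form v1 v2 v3 x1 x2 x3 = nine_point_form v2 v3 v1 x2 x3 x1.
Proof. by rewrite /nine_point_form; ring. Qed.

Lemma circumconic_center p q r c x1 x2 x3 :
  r * x2 + q * x3 = c -> p * x3 + r * x1 = c -> q * x1 + p * x2 = c ->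
  [/\ 2 * (p * q * r) * x1 = c * (p * (- p + q + r)),
      (* The linear system is solved by combining the equations with signs: q times the second plus
         r times the third minus p times the first leaves 2qr x1. A factor p then gives all three
         coordinates the common multiplier 2pqr. *)
      2 * (p * q * r) * x2 = c * (q * (p - q + r)) &
      2 * (p * q * r) * x3 = c * (r * (p + q - r))].
Proof.
move=> h1 h2 h3; split.
- transitivity (p * (q * (p * x3 + r * x1) + r * (q * x1 + p * x2)
                     - p * (r * x2 + q * x3))); first by ring.
  by rewrite h1 h2 h3; ring.
- transitivity (q * (p * (r * x2 + q * x3) + r * (q * x1 + p * x2)
                     - q * (p * x3 + r * x1))); first by ring.
  by rewrite h1 h2 h3; ring.
- transitivity (r * (p * (r * x2 + q * x3) + q * (p * x3 + r * x1)
                     - r * (q * x1 + p * x2))); first by ring.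
  by rewrite h1 h2 h3; ring.
Qed.

(** Once the center is expressed through p, q, r, the form becomes a multiple of the equation which
    says that the circumconic passes through v. Homogeneity allows x to be scaled by 2pqr first, so
    no division occurs. *)
Lemma nine_point_form_centered v1 v2 v3 x1 x2 x3 :
  centered v1 v2 v3 x1 x2 x3 -> nine_point_form v1 v2 v3 x1 x2 x3 = 0.
Proof.
move=> [p [q [r [c [h c0 hv [h1 h2 h3]]]]]].
have k0 : 2 * (p * q * r) != 0 by rewrite mulf_neq0 // neq0_2.
have [] := circumconic_center h1 h2 h3.
move: k0; set k := 2 * _ => k0 e1 e2 e3.
have : k ^+ 2 * nine_point_form v1 v2 v3 x1 x2 x3 =
    nine_point_form v1 v2 v3 (k * x1) (k * x2) (k * x3).
  by rewrite /nine_point_form; ring.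
rewrite e1 e2 e3.
have -> : nine_point_form v1 v2 v3 (c * (p * (- p + q + r)))
    (c * (q * (p - q + r))) (c * (r * (p + q - r))) =
  - c ^+ 2 * ((- p + q + r) * (p - q + r) * (p + q - r))
    * (p * v2 * v3 + q * v3 * v1 + r * v1 * v2).
  by rewrite /nine_point_form; ring.
rewrite hv mulr0 => /eqP; rewrite mulf_eq0 expf_eq0 (negbTE k0) /=.
by move/eqP.
Qed.

(** On the side x1 = 0 the form splits into two linear factors, one vanishing at the trace of v and
    the other at the midpoint. If the midpoint is not the trace, it is the center of a nondegenerate
    circumconic through v. *)
Lemma nine_point_form_side v1 v2 v3 x2 x3 :
  v1 != 0 -> v2 != 0 -> v3 != 0 -> v1 + v2 != 0 -> v3 + v1 != 0 ->
  (x2 != 0) || (x3 != 0) ->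
  nine_point_form v1 v2 v3 0 x2 x3 = 0 ->
  centered v1 v2 v3 0 x2 x3 \/ exists2 t, t != 0 & x2 = t * v2 /\ x3 = t * v3.
Proof.
move=> n1 n2 n3 n12 n31 x0.
have -> : nine_point_form v1 v2 v3 0 x2 x3 = v1 * ((v3 * x2 - v2 * x3) * (x2 - x3)).
  by rewrite /nine_point_form; ring.
move/eqP; rewrite !mulf_eq0 (negbTE n1) /= !subr_eq0.
case: (eqVneq (v3 * x2) (v2 * x3)) => [e _|ne /= /eqP e].
  right; exists (x3 / v3); last first.
    by split; [apply: (mulfI n3); rewrite e | ]; field.
  rewrite mulf_neq0 ?invr_neq0 //; apply: contraTneq x0 => z3.
  have : v3 * x2 == 0 by rewrite e z3 mulr0.
  by rewrite z3 eqxx orbF negbK mulf_eq0 (negbTE n3).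
left; subst x3; rewrite orbb in x0.
have n23 : v2 - v3 != 0.
  by apply: contraNneq ne => /eqP; rewrite subr_eq0 => /eqP ->.
(* By [circumconic_center], a center with x1 = 0 requires p = q + r. Together with passage through v
   this determines p, q, r up to a factor. *)
exists (v1 * (v2 - v3)), (v2 * (v3 + v1)), (- (v3 * (v1 + v2))), (v1 * (v2 - v3) * x2).
split; rewrite ?mulf_neq0 ?oppr_eq0 ?mulf_neq0 //; first by ring.
by split; ring.
Qed.

(** The passage from (p : q : r) to the center (p(-p+q+r) : q(p-q+r) : r(p+q-r)) is an involution,
    so the same formulas recover the conic from its center. It remains to see that the recovered
    conic is nondegenerate. *)
Lemma centered_nine_point_form v1 v2 v3 x1 x2 x3 :
  v1 != 0 -> v2 != 0 -> v3 != 0 ->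
  v1 + v2 != 0 -> v2 + v3 != 0 -> v3 + v1 != 0 ->
  x1 * x2 * x3 != 0 ->
  nine_point_form v1 v2 v3 x1 x2 x3 = 0 -> centered v1 v2 v3 x1 x2 x3.
Proof.
move=> n1 n2 n3 n12 n23 n31 x0 h.
(* The line y1 = y2 + y3 joins the midpoints of two sides. On it the form reduces to a nonzero
   multiple of y2 y3, so its only zeros there are these midpoints, which lie on the sides. *)
have noncollinear w1 w2 w3 y1 y2 y3 : w1 != 0 -> w2 + w3 != 0 ->
    y1 * y2 * y3 != 0 -> nine_point_form w1 w2 w3 y1 y2 y3 = 0 -> - y1 + y2 + y3 != 0.
  move=> m1 m23 y0 e; apply: contraNneq y0 => l.
  have ey : y1 = y2 + y3 by rewrite -[LHS]addr0 -l; ring.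
  move: e; rewrite ey.
  have -> : nine_point_form w1 w2 w3 (y2 + y3) y2 y3 = - 2 * w1 * (w2 + w3) * (y2 * y3).
    by rewrite /nine_point_form; ring.
  move/eqP; rewrite !mulf_eq0 oppr_eq0 (negbTE neq0_2) (negbTE m1) (negbTE m23) /=.
  by case/orP => ->; rewrite ?orbT.
have x0' : x2 * x3 * x1 != 0 by rewrite mulrC mulrA.
have x0'' : x3 * x1 * x2 != 0 by rewrite -mulrA mulrC.
have l1 := noncollinear _ _ _ _ _ _ n1 n23 x0 h.
have l2 : - x2 + x3 + x1 != 0.
  by apply: (noncollinear v2 v3 v1) => //; rewrite -nine_point_form_cyc.
have l3 : - x3 + x1 + x2 != 0.
  by apply: (noncollinear v3 v1 v2) => //; rewrite -nine_point_form_cyc -nine_point_form_cyc.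
move: (x0); rewrite !mulf_eq0 !negb_or => /andP[/andP[y1 y2] y3].
exists (x1 * (- x1 + x2 + x3)), (x2 * (- x2 + x3 + x1)), (x3 * (- x3 + x1 + x2)).
exists (2 * (x1 * x2 * x3)); split; rewrite ?mulf_neq0 ?neq0_2 //.
  by rewrite -[RHS]oppr0 -h /nine_point_form; ring.
by split; ring.
Qed.

Variable S : 'M[R]_3.
Hypothesis Su : S \in unitmx.
Hypothesis linfS : linf *m S = row3 1 1 1.
Variables A B C : 'cV[R]_3.
Hypothesis ptA : pt S A (col3 1 0 0).
Hypothesis ptB : pt S B (col3 0 1 0).
Hypothesis ptC : pt S C (col3 0 0 1).

Lemma ln_BC : ln S (join B C) (row3 1 0 0).
Proof.
have -> : row3 1 0 0 = join (col3 0 1 0) (col3 0 0 1) :> 'rV[R]_3.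
  by rewrite join_col3; congr row3; ring.
exact: ln_join.
Qed.

Lemma ln_CA : ln S (join C A) (row3 0 1 0).
Proof.
have -> : row3 0 1 0 = join (col3 0 0 1) (col3 1 0 0) :> 'rV[R]_3.
  by rewrite join_col3; congr row3; ring.
exact: ln_join.
Qed.

Lemma ln_AB : ln S (join A B) (row3 0 0 1).
Proof.
have -> : row3 0 0 1 = join (col3 1 0 0) (col3 0 1 0) :> 'rV[R]_3.
  by rewrite join_col3; congr row3; ring.
exact: ln_join.
Qed.

Lemma center_bary (M : 'M[R]_3) (X x : 'cV[R]_3) : pt S X x ->
  center M X <-> proj_eq (polar (S^T *m M *m S) x) (row3 1 1 1).
Proof.
by move=> hX; apply: ln_proj_eq (polar_bary Su M hX) (ln_linf Su linfS).
Qed.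

Lemma pt_trace_A V v1 v2 v3 : pt S V (col3 v1 v2 v3) ->
  pt S (meet (join A V) (join B C)) (col3 0 v2 v3).
Proof.
move=> hV; apply: pt_proj (pt_meet Su (ln_join Su ptA hV) ln_BC) _.
rewrite join_col3 meet_row3; exists 1; rewrite ?oner_neq0 // scale1r; congr col3; ring.
Qed.

Lemma pt_trace_B V v1 v2 v3 : pt S V (col3 v1 v2 v3) ->
  pt S (meet (join B V) (join C A)) (col3 v1 0 v3).
Proof.
move=> hV; apply: pt_proj (pt_meet Su (ln_join Su ptB hV) ln_CA) _.
rewrite join_col3 meet_row3; exists 1; rewrite ?oner_neq0 // scale1r; congr col3; ring.
Qed.

Lemma pt_trace_C V v1 v2 v3 : pt S V (col3 v1 v2 v3) ->
  pt S (meet (join C V) (join A B)) (col3 v1 v2 0).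
Proof.
move=> hV; apply: pt_proj (pt_meet Su (ln_join Su ptC hV) ln_AB) _.
rewrite join_col3 meet_row3; exists 1; rewrite ?oner_neq0 // scale1r; congr col3; ring.
Qed.

Lemma meetC_proj (l m : 'rV[R]_3) : proj_eq (meet l m) (meet m l).
Proof.
exists (- 1); first by rewrite oppr_eq0 oner_neq0.
by apply/matrixP => i j; rewrite !mxE; ring.
Qed.

Lemma centered_center V v1 v2 v3 X x1 x2 x3 :
  pt S V (col3 v1 v2 v3) -> pt S X (col3 x1 x2 x3) ->
  (exists M : 'M[R]_3, [/\ conic M,
       [/\ on_conic M A, on_conic M B, on_conic M C & on_conic M V] &
       center M X]) <-> centered v1 v2 v3 x1 x2 x3.
Proof.
move=> hV hX; split.
  move=> [M [cM [/(on_conic_bary M ptA) oA /(on_conic_bary M ptB) oB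
    /(on_conic_bary M ptC) oC /(on_conic_bary M hV) oV] /(center_bary M hX)]].
  have [p [q [r [pqr e]]]] := circumconicP (conic_congr Su cM) oA oB oC.
  rewrite e in oV *; move/on_circumconic in oV.
  rewrite /polar tr_col3 mul_row3_mat3 => -[c c0].
  rewrite scale_row3 !mulr1 => /row3_inj [h1 h2 h3].
  exists p, q, r, c; split=> //.
  by split; [rewrite -h1 | rewrite -h2 | rewrite -h3]; ring.
move=> [p [q [r [c [pqr c0 hv [h1 h2 h3]]]]]].
pose T := invmx S; have Tu : T \in unitmx by rewrite unitmx_inv.
pose M := T^T *m circumconic p q r *m T.
have eM : S^T *m M *m S = circumconic p q r.
  by rewrite /M /T trmx_inv !mulmxA mulmxV ?unitmx_tr // mul1mx mulmxKV.
exists M; split; first exact/conic_congr/circumconic_conic.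
  split.
  - by rewrite (on_conic_bary M ptA) eM; apply/on_circumconic; ring.
  - by rewrite (on_conic_bary M ptB) eM; apply/on_circumconic; ring.
  - by rewrite (on_conic_bary M ptC) eM; apply/on_circumconic; ring.
  - by rewrite (on_conic_bary M hV) eM; apply/on_circumconic.
rewrite (center_bary M hX) eM /polar tr_col3 mul_row3_mat3; exists c => //.
rewrite scale_row3 !mulr1 -{1}h1 -{1}h2 -{1}h3; congr row3; ring.
Qed.

(** A zero of the form off the sides is a center by [centered_nine_point_form]. On a side,
    [nine_point_form_side] yields either a center or the trace of [V], a diagonal point of the
    quadrangle; cyclic shifts reduce the three sides to one. *)
Lemma nine_point_conic_bary V v1 v2 v3 :
  pt S V (col3 v1 v2 v3) -> v1 != 0 -> v2 != 0 -> v3 != 0 ->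
  v1 + v2 != 0 -> v2 + v3 != 0 -> v3 + v1 != 0 ->
  nine_point_conic A B C V =
  conic_points ((invmx S)^T *m nine_point_mx v1 v2 v3 *m invmx S).
Proof.
move=> hV n1 n2 n3 n12 n23 n31.
have tA := proj_eq_trans (meetC_proj _ _) (pt_trace_A hV).
have tB := proj_eq_trans (meetC_proj _ _) (pt_trace_B hV).
have tC := proj_eq_trans (meetC_proj _ _) (pt_trace_C hV).
rewrite predeqE => X; have := pt_self Su X.
rewrite [invmx S *m X]col3_eta.
move: (_ i0 0) (_ i1 0) (_ i2 0) => x1 x2 x3 hX.
have -> : conic_points ((invmx S)^T *m nine_point_mx v1 v2 v3 *m invmx S) X <->
    col3 x1 x2 x3 != 0 /\ nine_point_form v1 v2 v3 x1 x2 x3 = 0.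
  rewrite /conic_points /= (pt_neq0 Su hX) (on_conic_bary _ hX).
  rewrite trmx_inv !mulmxA mulmxV ?unitmx_tr // mul1mx mulmxKV //.
  by rewrite on_nine_point_mx.
rewrite /nine_point_conic /= (centered_center hV hX).
rewrite (propext (pt_proj_eq Su hX tA)) (propext (pt_proj_eq Su hX tB)).
rewrite (propext (pt_proj_eq Su hX tC)).
have col3_eq0 : (col3 x1 x2 x3 == 0) = [&& x1 == 0, x2 == 0 & x3 == 0].
  apply/eqP/and3P => [|[/eqP -> /eqP -> /eqP ->]].
    have -> : 0 = col3 0 0 0 :> 'cV[R]_3.
      by apply/matrixP => i j; rewrite !mxE; move: i; apply: ord3P.
    by move/col3_inj => [-> -> ->].
  by apply/matrixP => i j; rewrite !mxE; move: i; apply: ord3P.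
rewrite col3_eq0; split.
  case=> [h|].
    split; last exact: nine_point_form_centered.
    case: h => p [q [r [c [_ c0 _ [h1 h2 h3]]]]]; apply: contra c0.
    by case/and3P => _ /eqP e2 /eqP e3; rewrite -h1 e2 e3 !mulr0 addr0.
  rewrite /nine_point_form.
  by case=> -[c c0]; rewrite scale_col3 => /col3_inj [-> -> ->];
    split; rewrite ?mulr0 ?mulf_eq0 ?(negbTE c0) ?(negbTE n1) ?(negbTE n2)
    ?(negbTE n3) ?andbF //; ring.
case=> x0 h; have [x123|] := boolP (x1 * x2 * x3 != 0).
  by left; apply: centered_nine_point_form.
rewrite negbK !mulf_eq0 -orbA => /or3P[] /eqP e; subst.
- have x0' : (x2 != 0) || (x3 != 0) by move: x0; rewrite eqxx /= negb_and.
  have [h'|[t t0 [e2 e3]]] := nine_point_form_side n1 n2 n3 n12 n31 x0' h.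
    by left.
  by right; constructor 1; exists t; rewrite // scale_col3 e2 e3 mulr0.
- have x0' : (x3 != 0) || (x1 != 0).
    by move: x0; rewrite eqxx /= negb_and orbC.
  rewrite nine_point_form_cyc in h.
  have [h'|[t t0 [e2 e3]]] := nine_point_form_side n2 n3 n1 n23 n12 x0' h.
    by left; apply: centered_cyc.
  by right; constructor 2; exists t; rewrite // scale_col3 e2 e3 mulr0.
- have x0' : (x1 != 0) || (x2 != 0).
    by move: x0; rewrite eqxx andbT negb_and.
  rewrite 2!nine_point_form_cyc in h.
  have [h'|[t t0 [e2 e3]]] := nine_point_form_side n3 n1 n2 n31 n23 x0' h.
    by left; do 2 apply: centered_cyc.
  by right; constructor 3; exists t; rewrite // scale_col3 e2 e3 mulr0.
Qed.

End NinePoint.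

(** * The affine maps, the inconic and the generalized orthocenter in terms of x, y, z *)

Section Core.
Variable R : realType.
Implicit Types (x y z p q r u v w k : R).

(** The map T_P in barycentric coordinates: its columns are the traces of P, scaled to coordinate
    sum 1. *)
Definition trace_mx x y z : 'M[R]_3 :=
  mat3 0 (x / (z + x)) (x / (x + y)) (y / (y + z)) 0 (y / (x + y))
       (z / (y + z)) (z / (z + x)) 0.

Definition anticomplement_mx : 'M[R]_3 := mat3 (- 1) 1 1 1 (- 1) 1 1 1 (- 1).

(** In running coordinates (X : Y : Z) this is the rationalized form of sqrt(X/x) + sqrt(Y/y) +
    sqrt(Z/z) = 0, cleared of denominators. *)
Definition inconic_mx x y z : 'M[R]_3 :=
  mat3 (y ^+ 2 * z ^+ 2) (- (x * y * z ^+ 2)) (- (x * y ^+ 2 * z))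
       (- (x * y * z ^+ 2)) (z ^+ 2 * x ^+ 2) (- (x ^+ 2 * y * z))
       (- (x * y ^+ 2 * z)) (- (x ^+ 2 * y * z)) (x ^+ 2 * y ^+ 2).

Definition phi_center x y z : 'cV[R]_3 :=
  col3 (x * (y - z) ^+ 2) (y * (z - x) ^+ 2) (z * (x - y) ^+ 2).

(** The prefactor makes each column sum to 1, because 8xyz plus the coordinate sum of [phi_center]
    equals (y+z)(z+x)(x+y). *)
Definition phi_mx x y z : 'M[R]_3 :=
  ((y + z) * (z + x) * (x + y))^-1 *:
    ((8 * x * y * z)%:M + phi_center x y z *m row3 1 1 1).

(* Vanishes exactly when H is the vertex A. *)
Definition ortho x y z := x * y + y * z + z * x - x ^+ 2.

Definition orthocenter x y z : 'cV[R]_3 :=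
  col3 (x * ortho y z x * ortho z x y) (y * ortho z x y * ortho x y z)
       (z * ortho x y z * ortho y z x).

(** This is [nine_point_mx] at the coordinates of H with the product of the three values of [ortho]
    divided out. *)
Definition ortho_nine_point_mx x y z : 'M[R]_3 :=
  mat3 (2 * y * z * ortho x y z) (- (z * (x + y)) ^+ 2) (- (y * (z + x)) ^+ 2)
       (- (z * (x + y)) ^+ 2) (2 * z * x * ortho y z x) (- (x * (y + z)) ^+ 2)
       (- (y * (z + x)) ^+ 2) (- (x * (y + z)) ^+ 2) (2 * x * y * ortho z x y).

Lemma det_trace_mx x y z : y + z != 0 -> z + x != 0 -> x + y != 0 ->
  \det (trace_mx x y z) = 2 * x * y * z / ((y + z) * (z + x) * (x + y)).
Proof. by move=> a0 b0 c0; rewrite det_mat3; field; rewrite a0 b0 c0. Qed.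

Lemma trace_mx_phi x y z : x != 0 -> y != 0 -> z != 0 ->
  y + z != 0 -> z + x != 0 -> x + y != 0 ->
  trace_mx x y z *m anticomplement_mx *m trace_mx (y * z) (z * x) (x * y)
  *m anticomplement_mx = phi_mx x y z.
Proof.
move=> x0 y0 z0 a0 b0 c0; rewrite /phi_mx scalar_mat3 mul_col3_row3 add_mat3 scale_mat3.
have a0' : z * x + x * y != 0.
  by rewrite (_ : _ + _ = x * (y + z)) ?mulf_neq0 //; ring.
have b0' : x * y + y * z != 0.
  by rewrite (_ : _ + _ = y * (z + x)) ?mulf_neq0 //; ring.
have c0' : y * z + z * x != 0.
  by rewrite (_ : _ + _ = z * (x + y)) ?mulf_neq0 //; ring.
rewrite !mul_mat3; congr mat3; field; rewrite ?a0 ?b0 ?c0 ?a0' ?b0' ?c0' ?x0 ?y0 ?z0 //.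
Qed.

(** This serves the case of H a vertex, where N_H is defined through the nine-point conic of
    ABCP'. *)
Lemma trace_mx_inconic x y z : y + z != 0 -> z + x != 0 -> x + y != 0 ->
  (trace_mx x y z *m anticomplement_mx)^T *m inconic_mx x y z
    *m (trace_mx x y z *m anticomplement_mx) =
  (4 * x * y * z / ((y + z) * (z + x) * (x + y)))
    *: nine_point_mx (y * z) (z * x) (x * y).
Proof.
move=> a0 b0 c0; rewrite mul_mat3 tr_mat3 !mul_mat3 scale_mat3.
by congr mat3; field; rewrite ?a0 ?b0 ?c0.
Qed.

Lemma phi_mx_inconic x y z : y + z != 0 -> z + x != 0 -> x + y != 0 ->
  (phi_mx x y z)^T *m inconic_mx x y z *m phi_mx x y z =
  (4 * x * y * z / ((y + z) * (z + x) * (x + y))) ^+ 2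
    *: ortho_nine_point_mx x y z.
Proof.
move=> a0 b0 c0; rewrite /phi_mx scalar_mat3 mul_col3_row3 add_mat3 scale_mat3.
rewrite tr_mat3 !mul_mat3 scale_mat3 /ortho.
by congr mat3; field; rewrite ?a0 ?b0 ?c0.
Qed.

Lemma nine_point_mx_orthocenter x y z :
  nine_point_mx (x * ortho y z x * ortho z x y) (y * ortho z x y * ortho x y z)
    (z * ortho x y z * ortho y z x) =
  (ortho x y z * ortho y z x * ortho z x y) *: ortho_nine_point_mx x y z.
Proof. by rewrite scale_mat3; congr mat3; rewrite /ortho; ring. Qed.

(** At the coordinates of P', both [phi_center] and 8xyz acquire the factor xyz, and the prefactor
    cancels it. Hence what is proved about P transfers to P' by substitution. *)
Lemma phi_mx_isotomic x y z : x != 0 -> y != 0 -> z != 0 ->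
  y + z != 0 -> z + x != 0 -> x + y != 0 ->
  phi_mx (y * z) (z * x) (x * y) = phi_mx x y z.
Proof.
move=> x0 y0 z0 a0 b0 c0; rewrite /phi_mx.
have -> : phi_center (y * z) (z * x) (x * y) = (x * y * z) *: phi_center x y z.
  by rewrite scale_col3; congr col3; ring.
have -> : 8 * (y * z) * (z * x) * (x * y) = x * y * z * (8 * x * y * z) by ring.
rewrite -scalemxAl -scale_scalar_mx -scalerDr scalerA; congr (_ *: _).
have -> : z * x + x * y = x * (y + z) by ring.
have -> : x * y + y * z = y * (z + x) by ring.
have -> : y * z + z * x = z * (x + y) by ring.
by field; rewrite x0 y0 z0 a0 b0 c0.
Qed.

(** The equations say that the 2-by-2 minors vanish; any nonzero coordinate of the second point then
    provides the factor. *)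
Lemma proj_eq_col3 x1 x2 x3 y1 y2 y3 :
  col3 x1 x2 x3 != 0 -> col3 y1 y2 y3 != 0 ->
  x1 * y2 = x2 * y1 -> x2 * y3 = x3 * y2 -> x3 * y1 = x1 * y3 ->
  proj_eq (col3 x1 x2 x3) (col3 y1 y2 y3).
Proof.
move=> x0 y0 h12 h23 h31.
suff [c e] : exists c, col3 x1 x2 x3 = c *: col3 y1 y2 y3.
  by exists c => //; apply: contraNneq x0 => c0; rewrite e c0 scale0r.
have [n1|] := boolP (y1 != 0).
  exists (x1 / y1); rewrite scale_col3; congr col3; first by field.
    by apply: (mulfI n1); rewrite mulrC -h12; field.
  by apply: (mulfI n1); rewrite mulrC h31; field.
rewrite negbK => /eqP e1; have [n2|] := boolP (y2 != 0).
  exists (x2 / y2); rewrite scale_col3; congr col3; last 2 first.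
  - by field.
  - by apply: (mulfI n2); rewrite mulrC -h23; field.
  by apply: (mulfI n2); rewrite mulrC h12; field.
rewrite negbK => /eqP e2; have [n3|] := boolP (y3 != 0).
  exists (x3 / y3); rewrite scale_col3; congr col3.
  - by apply: (mulfI n3); rewrite mulrC -h31; field.
  - by apply: (mulfI n3); rewrite mulrC h23; field.
  - by field.
rewrite negbK => /eqP e3; move/eqP: y0; case.
by rewrite e1 e2 e3; apply/matrixP => i j; rewrite !mxE; move: i; apply: ord3P.
Qed.

Lemma sqr_diff_neq0 x y : x != y -> x + y != 0 -> x ^+ 2 - y ^+ 2 != 0.
Proof. by move=> n m; rewrite subr_sqr mulf_neq0 // subr_eq0. Qed.

(** The two values of [ortho] differ by x^2 - y^2 up to sign. So for P off the medians and off the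
    anticomplementary sides, at most one of u, v, w vanishes. *)
Lemma ortho_neq0 x y z : x != y -> x + y != 0 ->
  ortho x y z = 0 -> ortho y z x != 0.
Proof.
move=> n m e; apply: contraNneq (sqr_diff_neq0 n m) => e'.
rewrite -(subrr (0 : R)) -{1}e' -e /ortho; apply/eqP; ring.
Qed.

Variable S : 'M[R]_3.
Hypothesis Su : S \in unitmx.
Hypothesis linfS : linf *m S = row3 1 1 1.
Variables A B C : 'cV[R]_3.
Hypothesis ptA : pt S A (col3 1 0 0).
Hypothesis ptB : pt S B (col3 0 1 0).
Hypothesis ptC : pt S C (col3 0 0 1).

Lemma aff_A : aff A = S *m col3 1 0 0.
Proof. by rewrite (aff_bary linfS ptA) !addr0 !divr1. Qed.

Lemma aff_B : aff B = S *m col3 0 1 0.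
Proof. by rewrite (aff_bary linfS ptB) addr0 add0r !divr1. Qed.

Lemma aff_C : aff C = S *m col3 0 0 1.
Proof. by rewrite (aff_bary linfS ptC) !add0r !divr1. Qed.

Lemma frame_ABC : frame A B C = S.
Proof.
by rewrite (frame_bary aff_A aff_B aff_C) -(scalar_mat3 1) mulmx1.
Qed.

Lemma pt_centroid : pt S (centroid A B C) (col3 1 1 1).
Proof.
rewrite /centroid aff_A aff_B aff_C -!mulmxDr !add_col3 ?addr0 ?add0r.
exact: proj_eq_refl.
Qed.

Lemma complement_bary : complement A B C =
  S *m mat3 0 (2^-1) (2^-1) (2^-1) 0 (2^-1) (2^-1) (2^-1) 0 *m invmx S.
Proof.
have n2 := neq0_2 R; have n3 : (3 : R) != 0 by rewrite Num.Theory.pnatr_eq0.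
rewrite /complement (homothety_bary Su linfS _ pt_centroid).
have -> : (1 - - 2^-1) / (1 + 1 + 1) = 2^-1 :> R by field.
by congr (_ *m _ *m _); congr mat3; ring.
Qed.

Lemma conj_mul (m n : 'M[R]_3) :
  S *m m *m invmx S *m (S *m n *m invmx S) = S *m (m *m n) *m invmx S.
Proof. by rewrite !mulmxA mulmxKV. Qed.

Lemma complement_anticomplement :
  complement A B C *m (S *m anticomplement_mx *m invmx S) = 1%:M.
Proof.
rewrite complement_bary conj_mul.
have -> : mat3 0 (2^-1) (2^-1) (2^-1) 0 (2^-1) (2^-1) (2^-1) 0 *m
   anticomplement_mx = 1%:M :> 'M[R]_3.
  have n2 := neq0_2 R; rewrite mul_mat3 scalar_mat3; congr mat3; by field.
by rewrite mulmx1 mulmxV.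
Qed.

Lemma complement_unit : complement A B C \in unitmx.
Proof. by have [] := mulmx1_unit complement_anticomplement. Qed.

Lemma inv_complement :
  invmx (complement A B C) = S *m anticomplement_mx *m invmx S.
Proof.
rewrite -[RHS](mulKmx complement_unit) complement_anticomplement.
by rewrite mulmx1.
Qed.

Lemma affine_map_bary x y z D E F :
  pt S D (col3 0 y z) -> pt S E (col3 x 0 z) -> pt S F (col3 x y 0) ->
  affine_map A B C D E F = S *m trace_mx x y z *m invmx S.
Proof.
move=> hD hE hF; rewrite /affine_map frame_ABC; congr (_ *m _).
rewrite (frame_bary (aff_bary linfS hD) (aff_bary linfS hE) (aff_bary linfS hF)).
by congr (_ *m _); rewrite !mul0r !add0r !addr0 /trace_mx [x + z]addrC.
Qed.

(** Tangency at a trace makes two coordinates of its polar vanish. These linear equations express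
    every entry of the matrix through the first one, which fixes the conic up to a scalar. *)
Lemma inconic_bary x y z D E F (I : 'M[R]_3) :
  x != 0 -> y != 0 -> z != 0 ->
  pt S D (col3 0 y z) -> pt S E (col3 x 0 z) -> pt S F (col3 x y 0) ->
  inconic A B C D E F I ->
  exists2 k, k != 0 & S^T *m I *m S = k *: inconic_mx x y z.
Proof.
move=> x0 y0 z0 hD hE hF [cI [_ tD] [_ tE] [_ tF]].
have [sM uM] := conic_congr Su cI.
move: tD; rewrite (ln_proj_eq Su (polar_bary Su I hD) (ln_BC Su ptB ptC)).
move: tE; rewrite (ln_proj_eq Su (polar_bary Su I hE) (ln_CA Su ptA ptC)).
move: tF; rewrite (ln_proj_eq Su (polar_bary Su I hF) (ln_AB Su ptA ptB)).
move: (S^T *m I *m S) sM uM => M sM uM.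
have := mat3_eta M.
have -> : M i1 i0 = M i0 i1 by rewrite -{1}sM mxE.
have -> : M i2 i0 = M i0 i2 by rewrite -{1}sM mxE.
have -> : M i2 i1 = M i1 i2 by rewrite -{1}sM mxE.
move: (M i0 i0) (M i1 i1) (M i2 i2) (M i1 i2) (M i0 i2) (M i0 i1) uM.
move=> a b c d e f + eM; rewrite eM {sM M eM} => uM.
rewrite /polar !tr_col3 !mul_row3_mat3.
move=> [k1 _]; rewrite scale_row3 => /row3_inj [f1 f2 _].
move=> [k2 _]; rewrite scale_row3 => /row3_inj [g1 _ g2].
move=> [k3 _]; rewrite scale_row3 => /row3_inj [_ g3 _].
have ef : f = - (a * x / y).
  by apply: (mulfI y0); rewrite -[LHS]subr0 -(mulr0 k1) -f1; field.
have ee : e = - (a * x / z).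
  by apply: (mulfI z0); rewrite -[LHS]subr0 -(mulr0 k2) -g1; field.
have eb : b = a * x ^+ 2 / y ^+ 2.
  apply: (mulfI y0); rewrite -[LHS]subr0 -(mulr0 k1) -f2 ef; field; exact: y0.
have ec : c = a * x ^+ 2 / z ^+ 2.
  apply: (mulfI z0); rewrite -[LHS]subr0 -(mulr0 k2) -g2 ee; field; exact: z0.
have ed : d = - (a * x ^+ 2 / (y * z)).
  apply: (mulfI z0); rewrite -[LHS]subr0 -(mulr0 k3) -g3 eb.
  by field; rewrite y0 z0.
have eM : mat3 a f e f b d e d c = (a / (y ^+ 2 * z ^+ 2)) *: inconic_mx x y z.
  rewrite scale_mat3 ef ee eb ec ed.
  by congr mat3; field; rewrite ?y0 ?z0.
exists (a / (y ^+ 2 * z ^+ 2)) => //.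
apply: contraTneq uM => k0; rewrite eM k0 scale0r unitmxE det0 unitfE eqxx //.
Qed.

Lemma on_line_row3 x y z a b c V :
  pt S V (col3 x y z) -> forall l, ln S l (row3 a b c) ->
  on_line V l <-> a * x + b * y + c * z = 0.
Proof.
by move=> hV l hl; rewrite (on_line_bary Su hV hl) mul_row3_col3 scalar_mx11_eq0.
Qed.

(** Up to factors among u, v, w, the equations of the three parallels are the proportionality
    conditions between H and [orthocenter], so only the nonvanishing of the latter needs an
    argument. *)
Lemma gen_orthocenter_bary x y z Q D E F H :
  x != 0 -> y != 0 -> z != 0 ->
  y + z != 0 -> z + x != 0 -> x + y != 0 ->
  x != y -> y != z -> z != x ->
  pt S D (col3 0 y z) -> pt S E (col3 x 0 z) -> pt S F (col3 x y 0) ->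
  pt S Q (col3 (x * (y + z)) (y * (z + x)) (z * (x + y))) ->
  gen_orthocenter A B C Q D E F H -> pt S H (orthocenter x y z).
Proof.
move=> x0 y0 z0 a0 b0 c0 xy yz zx hD hE hF hQ [H0].
have hl := ln_linf Su linfS.
have lA : ln S (parallel_through A (join Q D))
    (row3 0 (- (z * ortho y z x)) (y * ortho z x y)).
  move: (ln_join Su ptA (pt_meet Su (ln_join Su hQ hD) hl)).
  by rewrite join_col3 meet_row3 join_col3 /ortho; congr ln; congr row3; ring.
have lB : ln S (parallel_through B (join Q E))
    (row3 (z * ortho x y z) 0 (- (x * ortho z x y))).
  move: (ln_join Su ptB (pt_meet Su (ln_join Su hQ hE) hl)).
  by rewrite join_col3 meet_row3 join_col3 /ortho; congr ln; congr row3; ring.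
have lC : ln S (parallel_through C (join Q F))
    (row3 (- (y * ortho x y z)) (x * ortho y z x) 0).
  move: (ln_join Su ptC (pt_meet Su (ln_join Su hQ hF) hl)).
  by rewrite join_col3 meet_row3 join_col3 /ortho; congr ln; congr row3; ring.
have := pt_self Su H; rewrite [invmx S *m H]col3_eta.
move: (_ i0 0) (_ i1 0) (_ i2 0) => h1 h2 h3 hH.
rewrite (on_line_row3 hH lA) (on_line_row3 hH lB) (on_line_row3 hH lC).
move=> e1 e2 e3; apply: (pt_proj hH); apply: proj_eq_col3.
- by rewrite -(pt_neq0 Su hH).
- rewrite /orthocenter; apply/eqP.
  have -> : 0 = col3 0 0 0 :> 'cV[R]_3.
    by apply/matrixP => i j; rewrite !mxE; move: i; apply: ord3P.
  move/col3_inj => [/eqP f1 /eqP f2 /eqP f3].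
  (* If all three coordinates vanished, two of u, v, w would be 0, against [ortho_neq0]. *)
  move: f1 f2 f3; rewrite !mulf_eq0 (negbTE x0) (negbTE y0) (negbTE z0) /=.
  have [u0|un] := eqVneq (ortho x y z) 0.
    rewrite (negbTE (ortho_neq0 xy c0 u0)) /= => /eqP w0.
    by have := ortho_neq0 zx b0 w0; rewrite u0 eqxx.
  rewrite orbF => _ /eqP w0; rewrite orFb => /eqP v0.
  by have := ortho_neq0 yz a0 v0; rewrite w0 eqxx.
- apply/eqP; rewrite -subr_eq0 -(mulr0 (- ortho z x y)) -e3; apply/eqP; ring.
- apply/eqP; rewrite -subr_eq0 -(mulr0 (- ortho x y z)) -e1; apply/eqP; ring.
- apply/eqP; rewrite -subr_eq0 -(mulr0 (- ortho y z x)) -e2; apply/eqP; ring.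
Qed.


Lemma conic_points_conj (M N T : 'M[R]_3) k : k != 0 ->
  T^T *m (S^T *m M *m S) *m T = k *: N ->
  conic_points ((invmx S)^T *m N *m invmx S) =
  conic_points ((S *m T *m invmx S)^T *m M *m (S *m T *m invmx S)).
Proof.
move=> k0 e; rewrite -(conic_points_scale _ k0); congr conic_points.
by rewrite scalemxAl scalemxAr -e !trmx_mul !mulmxA.
Qed.

(** Both branches of the definition of N_H give the pullback of the inconic by [Phi]; the product
    uvw decides which branch applies. *)
Lemma nine_point_conic_H_bary x y z D E F D3 E3 F3 P' Q H (I : 'M[R]_3) :
  x != 0 -> y != 0 -> z != 0 ->
  y + z != 0 -> z + x != 0 -> x + y != 0 ->
  x != y -> y != z -> z != x ->
  pt S D (col3 0 y z) -> pt S E (col3 x 0 z) -> pt S F (col3 x y 0) ->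
  pt S D3 (col3 0 (z * x) (x * y)) -> pt S E3 (col3 (y * z) 0 (x * y)) ->
  pt S F3 (col3 (y * z) (z * x) 0) ->
  pt S P' (col3 (y * z) (z * x) (x * y)) ->
  pt S Q (col3 (x * (y + z)) (y * (z + x)) (z * (x + y))) ->
  gen_orthocenter A B C Q D E F H ->
  inconic A B C D E F I ->
  let Phi := S *m phi_mx x y z *m invmx S in
  nine_point_conic_H A B C P' (affine_map A B C D3 E3 F3) H =
  conic_points (Phi^T *m I *m Phi).
Proof.
move=> x0 y0 z0 a0 b0 c0 xy yz zx hD hE hF hD3 hE3 hF3 hP' hQ oH iI Phi.
have hH := gen_orthocenter_bary x0 y0 z0 a0 b0 c0 xy yz zx hD hE hF hQ oH.
have [k k0 eI] := inconic_bary x0 y0 z0 hD hE hF iI.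
have n2 := neq0_2 R.
have n4 : (4 : R) != 0 by rewrite Num.Theory.pnatr_eq0.
set u := ortho x y z; set v := ortho y z x; set w := ortho z x y.
set t := 4 * x * y * z / ((y + z) * (z + x) * (x + y)).
have t0 : t != 0 by rewrite !mulf_neq0 ?invr_neq0 ?mulf_neq0.
(* A vertex has two zero coordinates, which forces a factor to vanish. Conversely, at most one of u,
   v, w is 0, and then exactly one coordinate of H survives. *)
have vertexE : [\/ proj_eq H A, proj_eq H B | proj_eq H C] <-> u * v * w = 0.
  rewrite (propext (pt_proj_eq Su hH ptA)) (propext (pt_proj_eq Su hH ptB)).
  rewrite (propext (pt_proj_eq Su hH ptC)) /orthocenter -/u -/v -/w; split.
    case=> -[c _]; rewrite scale_col3 !mulr0 => /col3_inj [/eqP h1 /eqP h2 /eqP h3];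
      move: h1 h2 h3; rewrite !mulf_eq0 ?(negbTE x0) ?(negbTE y0) ?(negbTE z0) /=.
    - by move=> _ /orP[] /eqP -> _; rewrite ?mulr0 ?mul0r.
    - by move=> /orP[] /eqP -> _ _; rewrite ?mulr0 ?mul0r.
    - by move=> /orP[] /eqP -> _ _; rewrite ?mulr0 ?mul0r.
  move/eqP; rewrite !mulf_eq0 -orbA => /or3P[] /eqP e.
  - constructor 1; exists (x * v * w).
      rewrite !mulf_neq0 // ?(ortho_neq0 xy c0 e) //.
      by apply/eqP => w0; move: (ortho_neq0 zx b0 w0); rewrite -/u e eqxx.
    by rewrite scale_col3 e; congr col3; ring.
  - constructor 2; exists (y * w * u).
      rewrite !mulf_neq0 // ?(ortho_neq0 yz a0 e) //.
      by apply/eqP => w0; move: (ortho_neq0 xy c0 w0); rewrite -/v e eqxx.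
    by rewrite scale_col3 e; congr col3; ring.
  - constructor 3; exists (z * u * v).
      rewrite !mulf_neq0 // ?(ortho_neq0 zx b0 e) //.
      by apply/eqP => w0; move: (ortho_neq0 yz a0 w0); rewrite -/w e eqxx.
    by rewrite scale_col3 e; congr col3; ring.
pose T := S *m trace_mx x y z *m invmx S.
pose T' := S *m trace_mx (y * z) (z * x) (x * y) *m invmx S.
have sa : z * x + x * y = x * (y + z) by ring.
have sb : x * y + y * z = y * (z + x) by ring.
have sc : y * z + z * x = z * (x + y) by ring.
have nP' : [/\ y * z + z * x != 0, z * x + x * y != 0 & x * y + y * z != 0].
  by rewrite sa sb sc; split; rewrite mulf_neq0.
have [np1 np2 np3] := nP'.
(* The grouping (T_P K^-1)(T_P' K^-1) isolates the factor that carries the nine-point conic of ABCP'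
   to the inconic. *)
have ePhi : Phi = S *m (trace_mx x y z *m anticomplement_mx) *m invmx S
    *m (T' *m invmx (complement A B C)).
  by rewrite inv_complement /T' !conj_mul /Phi -trace_mx_phi // !mulmxA.
have T'u : T' \in unitmx.
  rewrite !unitmx_mul Su unitmx_inv Su andbT /= unitmxE unitfE det_trace_mx //.
  by rewrite !mulf_neq0 ?invr_neq0 ?mulf_neq0.
have Ku := complement_unit.
have nonvertex : u * v * w != 0 ->
    nine_point_conic A B C H = conic_points (Phi^T *m I *m Phi).
  move=> uvw; have := uvw; rewrite !mulf_eq0 !negb_or => /andP[/andP[u0 v0] w0].
  rewrite (@nine_point_conic_bary _ _ Su linfS _ _ _ ptA ptB ptC _ _ _ _ hH)
    ?mulf_neq0 //; last 3 first.
  (* These factorizations show that H avoids the sides of the anticomplementary triangle, as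
     [nine_point_conic_bary] requires. *)
  - have -> : x * ortho y z x * ortho z x y + y * ortho z x y * ortho x y z =
      w * (z * (x + y) ^+ 2) by rewrite /w /ortho; ring.
    by rewrite !mulf_neq0.
  - have -> : y * ortho z x y * ortho x y z + z * ortho x y z * ortho y z x =
      u * (x * (y + z) ^+ 2) by rewrite /u /ortho; ring.
    by rewrite !mulf_neq0.
  - have -> : z * ortho x y z * ortho y z x + x * ortho y z x * ortho z x y =
      v * (y * (z + x) ^+ 2) by rewrite /v /ortho; ring.
    by rewrite !mulf_neq0.
  have k'0 : k * t ^+ 2 / (u * v * w) != 0.
    by apply: mulf_neq0; [apply: mulf_neq0; rewrite ?expf_neq0 | rewrite invr_neq0].
  apply: (conic_points_conj k'0).
  rewrite eI -[_ *m (k *: _)]scalemxAr -[(k *: _) *m _]scalemxAl phi_mx_inconic // nine_point_mx_orthocenter.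
  by rewrite !scalerA -/t -/u -/v -/w mulfVK.
have vertex : [set complement A B C *m Y | Y in
    [set invmx T' *m X | X in nine_point_conic A B C P']] =
    conic_points (Phi^T *m I *m Phi).
  rewrite (@nine_point_conic_bary _ _ Su linfS _ _ _ ptA ptB ptC _ _ _ _ hP')
    ?mulf_neq0 //.
  (* Writing K as the inverse of K^-1 turns the image under K into a second preimage. *)
  rewrite conic_points_preimage // -[complement A B C in LHS]invmxK.
  rewrite conic_points_preimage ?unitmx_inv //.
  have kt : k * t != 0 by rewrite mulf_neq0.
  rewrite -(conic_points_scale _ kt); congr conic_points.
  rewrite ePhi; do 3 rewrite scalemxAl scalemxAr.
  have -> : k * t *: nine_point_mx (y * z) (z * x) (x * y) =
     (trace_mx x y z *m anticomplement_mx)^T *m (S^T *m I *m S)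
       *m (trace_mx x y z *m anticomplement_mx).
    by rewrite eI -[_ *m (k *: _)]scalemxAr -[(k *: _) *m _]scalemxAl trace_mx_inconic // scalerA.
  by rewrite !trmx_mul !mulmxA.
rewrite (affine_map_bary hD3 hE3 hF3) -/T'.
rewrite predeqE /nine_point_conic_H => X /=; rewrite (propext vertexE).
have [h|h] := eqVneq (u * v * w) 0.
  by rewrite -vertex /=; split=> [[[]|[]]|hX] //; right.
by rewrite (nonvertex h); split=> [[[]|[/eqP]]|hX] //; [rewrite (negbTE h) | left; split=> //; apply/eqP].
Qed.

End Core.

(** * The center of the conic ABCPQ and the decomposition of the map [Phi] *)

Section Center.
Variable R : realType.

Lemma conic_through_P_Q (x y z p q r : R) :
  x != 0 -> y != 0 -> z != 0 ->
  y + z != 0 -> z + x != 0 -> x + y != 0 ->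
  x != y -> y != z -> z != x ->
  p * y * z + q * z * x + r * x * y = 0 ->
  p * (y * (z + x)) * (z * (x + y)) + q * (z * (x + y)) * (x * (y + z))
    + r * (x * (y + z)) * (y * (z + x)) = 0 ->
  exists k, [/\ p = k * (x * (y ^+ 2 - z ^+ 2)), q = k * (y * (z ^+ 2 - x ^+ 2))
    & r = k * (z * (x ^+ 2 - y ^+ 2))].
Proof.
move=> x0 y0 z0 a0 b0 c0 xy yz zx hP hQ.
have b0' : y * (z ^+ 2 - x ^+ 2) != 0 by rewrite mulf_neq0 // sqr_diff_neq0.
have zx0 : z - x != 0 by rewrite subr_eq0.
exists (q / (y * (z ^+ 2 - x ^+ 2))); split; last 2 first.
- by rewrite mulfVK.
- apply: (mulIf b0'); rewrite mulrAC mulfVK //.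
  apply: (mulIf x0); apply/eqP; rewrite -subr_eq0; apply/eqP.
  (* Subtracting this multiple of the equation at P from the one at Q eliminates p and relates q to
     r; the next case eliminates r in the same way. *)
  transitivity ((p * (y * (z + x)) * (z * (x + y)) + q * (z * (x + y)) * (x * (y + z))
    + r * (x * (y + z)) * (y * (z + x)))
    - (z + x) * (x + y) * (p * y * z + q * z * x + r * x * y)); first by ring.
  by rewrite hP hQ mulr0 subr0.
- apply: (mulIf b0'); rewrite mulrAC mulfVK //.
  apply: (mulIf z0); apply/eqP; rewrite -subr_eq0; apply/eqP.
  transitivity ((y + z) * (z + x) * (p * y * z + q * z * x + r * x * y)
    - (p * (y * (z + x)) * (z * (x + y)) + q * (z * (x + y)) * (x * (y + z))
    + r * (x * (y + z)) * (y * (z + x)))); first by ring.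
  by rewrite hP hQ mulr0 subr0.
Qed.

(** The normalization k + c Z3 = 1, with Z3 the last coordinate, separates the cases: an infinite Z
    forces k = 1, a translation, while an ordinary Z gives a homothety of ratio k. *)
Lemma homology_cases (Phi : 'M[R]_3) (Z : 'cV[R]_3) (k c : R) :
  Z != 0 -> k != 0 -> c != 0 ->
  Phi = k%:M + c *: (Z *m linf) -> k + c * Z ord_max 0 = 1 ->
  homothety_with_center Phi Z \/ translation_with_center Phi Z.
Proof.
move=> Z0 k0 c0 ePhi e; have [z0|z0] := eqVneq (Z ord_max 0) 0.
  have k1 : k = 1 by rewrite -e z0 mulr0 addr0.
  right; split=> //; last by exists c; rewrite // ePhi k1; exact: proj_eq_refl.
  rewrite /on_line [LHS]mx11_scalar -linf_coord z0.
  by apply/matrixP => i j; rewrite !mxE mul0rn.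
left; split=> //; exists k; split=> //.
  apply: contra_neq z0 => k1; apply: (mulfI c0); rewrite mulr0.
  by apply: (addrI k); rewrite e k1 addr0.
rewrite ePhi /homothety /aff -scalemxAl scalerA.
have -> : 1 - k = c * Z ord_max 0 by rewrite -e; ring.
by rewrite mulfK //; apply: proj_eq_refl.
Qed.

Lemma homology_fix (Phi : 'M[R]_3) (Z : 'cV[R]_3) (k c : R) :
  Phi = k%:M + c *: (Z *m linf) -> k + c * Z ord_max 0 = 1 -> Phi *m Z = Z.
Proof.
move=> -> e; rewrite mulmxDl mul_scalar_mx -scalemxAl -mulmxA.
rewrite [linf *m Z]mx11_scalar -linf_coord mul_mx_scalar scalerA -scalerDl.
by rewrite e scale1r.
Qed.

(* A homothety or translation with center Z preserves every line through Z. *)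
Lemma homology_tangent (Phi I : 'M[R]_3) (Z : 'cV[R]_3) (k c : R) :
  k != 0 -> Phi = k%:M + c *: (Z *m linf) -> k + c * Z ord_max 0 = 1 ->
  on_conic I Z -> tangent_conics_at (Phi^T *m I *m Phi) I Z.
Proof.
move=> k0 ePhi e oZ; have fZ := homology_fix ePhi e; split=> //.
  by apply/on_conic_congr; rewrite fZ.
exists k => //; rewrite polar_congr fZ ePhi mulmxDr mul_mx_scalar -scalemxAr mulmxA.
by rewrite /polar oZ mul0mx scaler0 addr0.
Qed.

Variable S : 'M[R]_3.
Hypothesis Su : S \in unitmx.
Hypothesis linfS : linf *m S = row3 1 1 1.
Variables A B C : 'cV[R]_3.
Hypothesis ptA : pt S A (col3 1 0 0).
Hypothesis ptB : pt S B (col3 0 1 0).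
Hypothesis ptC : pt S C (col3 0 0 1).

Lemma center_conic_bary (x y z : R) P Q Z (M : 'M[R]_3) :
  x != 0 -> y != 0 -> z != 0 ->
  y + z != 0 -> z + x != 0 -> x + y != 0 ->
  x != y -> y != z -> z != x ->
  pt S P (col3 x y z) ->
  pt S Q (col3 (x * (y + z)) (y * (z + x)) (z * (x + y))) ->
  conic M ->
  [/\ on_conic M A, on_conic M B, on_conic M C, on_conic M P & on_conic M Q] ->
  center M Z -> pt S Z (phi_center x y z).
Proof.
move=> x0 y0 z0 a0 b0 c0 xy yz zx hP hQ cM.
move=> [/(on_conic_bary M ptA) oA /(on_conic_bary M ptB) oB
  /(on_conic_bary M ptC) oC /(on_conic_bary M hP) oP /(on_conic_bary M hQ) oQ].
have [p [q [r [pqr e]]]] := circumconicP (conic_congr Su cM) oA oB oC.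
rewrite e in oP oQ; move/on_circumconic: oP => oP; move/on_circumconic: oQ => oQ.
have [k [ep eq er]] := conic_through_P_Q x0 y0 z0 a0 b0 c0 xy yz zx oP oQ.
have := pt_self Su Z; rewrite [invmx S *m Z]col3_eta.
move: (_ i0 0) (_ i1 0) (_ i2 0) => h1 h2 h3 hZ.
move=> /(center_bary Su linfS M hZ); rewrite e /polar tr_col3 mul_row3_mat3 => -[c cn0].
rewrite scale_row3 !mulr1 => /row3_inj [e1 e2 e3].
have [] := @circumconic_center _ p q r c h1 h2 h3.
- by rewrite -e1; ring.
- by rewrite -e2; ring.
- by rewrite -e3; ring.
have k0 : k != 0.
  by apply: contraNneq pqr => k0; rewrite ep k0 !mul0r.
have d0 : 2 * (p * q * r) != 0 by rewrite mulf_neq0 // neq0_2.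
move: d0; set d := 2 * _ => d0 f1 f2 f3.
apply: (pt_proj hZ).
(* With these parameters -p + q + r equals -k (z+x)(x+y)(y-z), and cyclically. Hence p(-p+q+r) is
   x(y-z)^2 times the common factor -k^2 (y+z)(z+x)(x+y). *)
exists (- c * k ^+ 2 * ((y + z) * (z + x) * (x + y)) / d).
  apply: mulf_neq0; last exact: invr_neq0.
  by rewrite !mulf_neq0 ?oppr_eq0 ?expf_neq0.
rewrite scale_col3; congr col3; apply: (mulfI d0).
- by rewrite f1 ep eq er; field.
- by rewrite f2 ep eq er; field.
- by rewrite f3 ep eq er; field.
Qed.

Lemma phi_decomposition (x y z : R) Z :
  x != 0 -> y != 0 -> z != 0 ->
  y + z != 0 -> z + x != 0 -> x + y != 0 ->
  pt S Z (phi_center x y z) ->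
  exists k c, [/\ k != 0, c != 0,
    S *m phi_mx x y z *m invmx S = k%:M + c *: (Z *m linf)
    & k + c * Z ord_max 0 = 1].
Proof.
move=> x0 y0 z0 a0 b0 c0 [d d0 eZ].
have n8 : (8 : R) != 0 by rewrite Num.Theory.pnatr_eq0.
set s := (y + z) * (z + x) * (x + y).
have s0 : s != 0 by rewrite !mulf_neq0.
exists (s^-1 * (8 * x * y * z)), (s^-1 * d^-1); split.
- by rewrite !mulf_neq0 ?invr_neq0.
- by rewrite mulf_neq0 ?invr_neq0.
- rewrite /phi_mx -/s -scalemxAr -scalemxAl mulmxDr mulmxDl scalerDr.
  rewrite mul_mx_scalar -[_ *: S *m _]scalemxAl mulmxV // scalemx1 scale_scalar_mx.
  congr (_ + _).
  have -> : Z *m linf = d *: (S *m (phi_center x y z *m row3 1 1 1) *m invmx S).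
    by rewrite eZ -[(d *: _) *m _]scalemxAl -linfS !mulmxA mulmxK.
  by rewrite scalerA mulfVK.
- rewrite eZ (last_coord linfS) /s; field.
  by rewrite d0 a0 b0 c0.
Qed.

(** Dividing the coordinates by x, y, z leaves the squares of y-z, z-x, x-y, whose sum is 0; this
    solves the square-root form of the inconic. *)
Lemma on_inconic_center (x y z : R) : on_conic (inconic_mx x y z) (phi_center x y z).
Proof. by apply/on_conic_mat3; ring. Qed.

End Center.

(** * The frame attached to a triangle *)

Lemma triangle_frame (R : realType) (A B C : 'cV[R]_3) : triangle A B C ->
  let S := frame A B C in
  [/\ S \in unitmx, linf *m S = row3 1 1 1 &
   [/\ pt S A (col3 1 0 0), pt S B (col3 0 1 0) & pt S C (col3 0 0 1)]].
Proof.
move=> [oA oB oC nC] S.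
have lastA (X : 'cV[R]_3) : ordinary X -> linf *m aff X = 1%:M.
  move=> oX; rewrite [LHS]mx11_scalar -linf_coord /aff mxE mulVf //.
have SA : S *m col3 1 0 0 = aff A.
  by apply/matrixP => i j; rewrite ord1 mxE sum3 !mxE /= mulr1 !mulr0 !addr0.
have SB : S *m col3 0 1 0 = aff B.
  by apply/matrixP => i j; rewrite ord1 mxE sum3 !mxE /= mulr1 !mulr0 addr0 add0r.
have SC : S *m col3 0 0 1 = aff C.
  by apply/matrixP => i j; rewrite ord1 mxE sum3 !mxE /= mulr1 !mulr0 !add0r.
have ptX X x : ordinary X -> S *m x = aff X -> pt S X x.
  move=> oX e; exists (X ord_max 0) => //.
  by rewrite e /aff scalerA mulfV // scale1r.
have hA := ptX _ _ oA SA; have hB := ptX _ _ oB SB; have hC := ptX _ _ oC SC.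
split=> //.
  (* If the determinant were 0, [join_mul] would put C on the line AB. *)
  rewrite unitmxE unitfE; apply: contra_notN nC => /eqP d0.
  have [a a0 ->] := hA; have [b b0 ->] := hB; have [c c0 ->] := hC.
  rewrite /on_line.
  have [t _ ->] := proj_eq_join (ex_intro2 _ _ a a0 (erefl (a *: (S *m col3 1 0 0))))
    (ex_intro2 _ _ b b0 (erefl (b *: (S *m col3 0 1 0)))).
  by rewrite -scalemxAl -scalemxAr mulmxA join_mul d0 scale0r mul0mx !scaler0.
have col_sum x1 x2 x3 X : ordinary X -> S *m col3 x1 x2 x3 = aff X ->
    (linf *m S *m col3 x1 x2 x3) 0 0 = 1.
  by move=> oX e; rewrite -mulmxA e lastA // mxE.
have := col_sum _ _ _ _ oA SA; have := col_sum _ _ _ _ oB SB.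
have := col_sum _ _ _ _ oC SC.
rewrite [linf *m S]row3_eta !mul_row3_col3 !mxE /=.
rewrite !mulr0 !mulr1 !addr0 !add0r !mulr1n => e3 e2 e1.
by congr row3.
Qed.

(** * Translation of the configuration into coordinates, and assembly of the five claims *)

Theorem mainTheorem4 (R : realType) (A B C P : 'cV[R]_3) :
  let K := complement A B C in
  let D := meet (join A P) (join B C) in
  let E := meet (join B P) (join C A) in
  let F := meet (join C P) (join A B) in
  let D3 := reflection (midpoint B C) *m D in
  let E3 := reflection (midpoint C A) *m E in
  let F3 := reflection (midpoint A B) *m F in
  let P' := meet (join A D3) (join B E3) in
  let Q := K *m P' in
  let Q' := K *m P in
  let TP := affine_map A B C D E F in
  let TP' := affine_map A B C D3 E3 F3 in
  let Phi := TP *m invmx K *m TP' *m invmx K in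
  triangle A B C ->
  P != 0 ->
  ~ on_sides A B C P ->
  ~ on_sides (invmx K *m A) (invmx K *m B) (invmx K *m C) P ->
  ~ on_median A B C P ->
  forall (H H' Z : 'cV[R]_3) (CP I I' : 'M[R]_3),
  gen_orthocenter A B C Q D E F H ->
  gen_orthocenter A B C Q' D3 E3 F3 H' ->
  conic CP ->
  [/\ on_conic CP A, on_conic CP B, on_conic CP C, on_conic CP P
    & on_conic CP Q] ->
  center CP Z ->
  inconic A B C D E F I ->
  inconic A B C D3 E3 F3 I' ->
  let NH := nine_point_conic_H A B C P' TP' H in
  let NH' := nine_point_conic_H A B C P TP H' in
  [/\ [set Phi *m X | X in NH] = conic_points I /\ proj_eq (Phi *m Z) Z,
      conic_points I Z,
      exists N : 'M[R]_3,
        [/\ conic N, NH = conic_points N & tangent_conics_at N I Z],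
      [set Phi *m X | X in NH'] = conic_points I'
    & homothety_with_center Phi Z \/ translation_with_center Phi Z].
Proof.
move=> K D E F D3 E3 F3 P' Q Q' TP TP' Phi.
move=> /triangle_frame; set S := frame A B C => -[Su linfS [ptA ptB ptC]] _.
have := pt_self Su P; rewrite [invmx S *m P]col3_eta.
move: (_ i0 0) (_ i1 0) (_ i2 0) => x y z hP.
have lBC := ln_BC Su ptB ptC; have lCA := ln_CA Su ptA ptC.
have lAB := ln_AB Su ptA ptB.
move=> side antiside median.
(* Each excluded line gives one inequality: the sides give the coordinates, the anticomplementary
   sides their pairwise sums, the medians their differences. *)
have eq0_of (a : R) (Q0 : Prop) : (a = 0 -> Q0) -> ~ Q0 -> a != 0.
  by move=> h n; apply/eqP => /h.
have x0 : x != 0.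
  apply: eq0_of side => e; constructor 1; apply/(on_line_row3 Su hP lBC); rewrite e; ring.
have y0 : y != 0.
  apply: eq0_of side => e; constructor 2; apply/(on_line_row3 Su hP lCA); rewrite e; ring.
have z0 : z != 0.
  apply: eq0_of side => e; constructor 3; apply/(on_line_row3 Su hP lAB); rewrite e; ring.
have eK := inv_complement Su linfS ptA ptB ptC; rewrite -/K in eK.
have hA' := pt_mul Su ptA eK; rewrite mul_mat3_col3 in hA'.
have hB' := pt_mul Su ptB eK; rewrite mul_mat3_col3 in hB'.
have hC' := pt_mul Su ptC eK; rewrite mul_mat3_col3 in hC'.
have a0 : y + z != 0.
  apply: eq0_of antiside => e; constructor 1.
  have := ln_join Su hB' hC'; rewrite join_col3 => /(on_line_row3 Su hP) ->.
  by transitivity (2 * (y + z)); [ring | rewrite e mulr0].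
have b0 : z + x != 0.
  apply: eq0_of antiside => e; constructor 2.
  have := ln_join Su hC' hA'; rewrite join_col3 => /(on_line_row3 Su hP) ->.
  by transitivity (2 * (z + x)); [ring | rewrite e mulr0].
have c0 : x + y != 0.
  apply: eq0_of antiside => e; constructor 3.
  have := ln_join Su hA' hB'; rewrite join_col3 => /(on_line_row3 Su hP) ->.
  by transitivity (2 * (x + y)); [ring | rewrite e mulr0].
have hG := pt_centroid linfS ptA ptB ptC.
have yz : y != z.
  rewrite -subr_eq0; apply: eq0_of median => e; constructor 1.
  have := ln_join Su ptA hG; rewrite join_col3 => /(on_line_row3 Su hP) ->.
  by transitivity (- (y - z)); [ring | rewrite e oppr0].
have zx : z != x.
  rewrite -subr_eq0; apply: eq0_of median => e; constructor 2.
  have := ln_join Su ptB hG; rewrite join_col3 => /(on_line_row3 Su hP) ->.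
  by transitivity (- (z - x)); [ring | rewrite e oppr0].
have xy : x != y.
  rewrite -subr_eq0; apply: eq0_of median => e; constructor 3.
  have := ln_join Su ptC hG; rewrite join_col3 => /(on_line_row3 Su hP) ->.
  by transitivity (- (x - y)); [ring | rewrite e oppr0].
have hD : pt S D (col3 0 y z) by apply: pt_trace_A hP.
have hE : pt S E (col3 x 0 z) by apply: pt_trace_B hP.
have hF : pt S F (col3 x y 0) by apply: pt_trace_C hP.
have n2 := neq0_2 R.
(* The coefficient in [homothety_bary] for ratio -1 and a midpoint whose coordinates sum to 2. *)
have half : (1 - - 1) / 2 = 1 :> R by field.
have eA := aff_A linfS ptA; have eB := aff_B linfS ptB; have eC := aff_C linfS ptC.
have hD3 : pt S D3 (col3 0 z y).
  have hm : pt S (midpoint B C) (col3 0 1 1).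
    rewrite /midpoint eB eC -mulmxDr add_col3 ?addr0 ?add0r; exact: proj_eq_refl.
  have := pt_mul Su hD (homothety_bary Su linfS (-1) hm).
  by rewrite mul_mat3_col3 add0r half; congr pt; congr col3; ring.
have hE3 : pt S E3 (col3 z 0 x).
  have hm : pt S (midpoint C A) (col3 1 0 1).
    rewrite /midpoint eC eA -mulmxDr add_col3 ?addr0 ?add0r; exact: proj_eq_refl.
  have := pt_mul Su hE (homothety_bary Su linfS (-1) hm).
  by rewrite mul_mat3_col3 addr0 half; congr pt; congr col3; ring.
have hF3 : pt S F3 (col3 y x 0).
  have hm : pt S (midpoint A B) (col3 1 1 0).
    rewrite /midpoint eA eB -mulmxDr add_col3 ?addr0 ?add0r; exact: proj_eq_refl.
  have := pt_mul Su hF (homothety_bary Su linfS (-1) hm).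
  by rewrite mul_mat3_col3 addr0 half; congr pt; congr col3; ring.
have hP' : pt S P' (col3 (y * z) (z * x) (x * y)).
  have := pt_meet Su (ln_join Su ptA hD3) (ln_join Su ptB hE3).
  by rewrite !join_col3 meet_row3; congr pt; congr col3; ring.
have cK := complement_bary Su linfS ptA ptB ptC.
have hQ : pt S Q (col3 (x * (y + z)) (y * (z + x)) (z * (x + y))).
  have := pt_mul Su hP' cK; rewrite mul_mat3_col3 => /pt_proj; apply.
  by exists 2^-1; rewrite ?invr_neq0 // scale_col3; congr col3; ring.
have scale_pt t X x1 x2 x3 : t != 0 ->
    pt S X (col3 x1 x2 x3) -> pt S X (col3 (t * x1) (t * x2) (t * x3)).
  move=> t0 /pt_proj; apply; apply: proj_eq_sym.
  by exists t; rewrite ?scale_col3.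
have xyz0 : x * y * z != 0 by rewrite !mulf_neq0.
have hQ' : pt S Q' (col3 (y * z * (z * x + x * y)) (z * x * (x * y + y * z))
                       (x * y * (y * z + z * x))).
  have := pt_mul Su hP cK; rewrite mul_mat3_col3 => h.
  have t0 : 2 * (x * y * z) != 0 by rewrite mulf_neq0.
  by move: (scale_pt _ _ _ _ _ t0 h); congr pt; congr col3; field.
move=> H H' Z CP I I' oH oH' cCP onCP cZ iI iI' NH NH'.
(* The reflected traces are rescaled to the shape of traces of (yz : zx : xy), so that the lemmas
   stated for P apply to P'. *)
have := scale_pt _ _ _ _ _ x0 hD3; rewrite mulr0 [x * z]mulrC => hD3'.
have := scale_pt _ _ _ _ _ y0 hE3; rewrite mulr0 [y * x]mulrC => hE3'.
have := scale_pt _ _ _ _ _ z0 hF3; rewrite mulr0 [z * y]mulrC => hF3'.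
have eTP := affine_map_bary linfS ptA ptB ptC hD hE hF.
have eTP' := affine_map_bary linfS ptA ptB ptC hD3' hE3' hF3'.
have ePhi : Phi = S *m phi_mx x y z *m invmx S.
  by rewrite /Phi /TP /TP' eTP eTP' eK !conj_mul // trace_mx_phi.
have nza : z * x + x * y != 0 by rewrite mulrC -mulrDr addrC mulf_neq0.
have nzb : x * y + y * z != 0 by rewrite mulrC -mulrDr addrC mulf_neq0.
have nzc : y * z + z * x != 0 by rewrite mulrC -mulrDr addrC mulf_neq0.
have Phiu : Phi \in unitmx.
  have Ku := complement_unit Su linfS ptA ptB ptC.
  have trace_unit t : \det t != 0 -> S *m t *m invmx S \in unitmx.
    by move=> t0; rewrite !unitmx_mul unitmx_inv Su andbT unitmxE unitfE.
  have TPu : TP \in unitmx.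
    rewrite /TP eTP trace_unit // det_trace_mx //.
    by rewrite !mulf_neq0 ?invr_neq0 ?mulf_neq0.
  have TP'u : TP' \in unitmx.
    rewrite /TP' eTP' trace_unit // det_trace_mx //.
    by rewrite !mulf_neq0 ?invr_neq0 ?mulf_neq0.
  by rewrite 3!unitmx_mul !unitmx_inv TPu TP'u Ku.
have hZ := center_conic_bary Su linfS ptA ptB ptC x0 y0 z0 a0 b0 c0 xy yz zx
  hP hQ cCP onCP cZ.
have [k [c [k0 cn0 dPhi e1]]] := phi_decomposition Su linfS x0 y0 z0 a0 b0 c0 hZ.
rewrite -ePhi in dPhi.
have eNH : NH = conic_points (Phi^T *m I *m Phi).
  have := nine_point_conic_H_bary Su linfS ptA ptB ptC x0 y0 z0 a0 b0 c0 xy yz zx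
    hD hE hF hD3' hE3' hF3' hP' hQ oH iI.
  by rewrite /= -ePhi.
have eNH' : NH' = conic_points (Phi^T *m I' *m Phi).
  (* The roles of P and P' are exchanged: conjugating (yz : zx : xy) again gives xyz times (x : y :
     z), hence the rescaling of P and its traces by xyz. *)
  have := scale_pt _ _ _ _ _ xyz0 hD; rewrite mulr0 => hD'.
  have := scale_pt _ _ _ _ _ xyz0 hE; rewrite mulr0 => hE'.
  have := scale_pt _ _ _ _ _ xyz0 hF; rewrite mulr0 => hF'.
  have hP'' := scale_pt _ _ _ _ _ xyz0 hP.
  have ex : x * y * z * x = z * x * (x * y) by ring.
  have ey : x * y * z * y = x * y * (y * z) by ring.
  have ez : x * y * z * z = y * z * (z * x) by ring.
  rewrite {}ex {}ey {}ez in hD' hE' hF' hP''.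
  have xy' : y * z != z * x by rewrite mulrC (inj_eq (mulfI z0)) eq_sym.
  have yz' : z * x != x * y by rewrite mulrC (inj_eq (mulfI x0)) eq_sym.
  have zx' : x * y != y * z by rewrite mulrC (inj_eq (mulfI y0)) eq_sym.
  have nx : y * z != 0 by rewrite mulf_neq0.
  have ny : z * x != 0 by rewrite mulf_neq0.
  have nz : x * y != 0 by rewrite mulf_neq0.
  have := nine_point_conic_H_bary Su linfS ptA ptB ptC nx ny nz nza nzb nzc
    xy' yz' zx' hD3' hE3' hF3' hD' hE' hF' hP'' hQ' oH' iI'.
  by rewrite /= phi_mx_isotomic // -ePhi.
(* The polar of the zero vector is zero, hence not a multiple of [linf] by a nonzero scalar. *)
have Z0 : Z != 0.
  apply: contra_neq cn0 => Z0; move: cZ => [t t0].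
  rewrite Z0 /polar trmx0 mul0mx => /matrixP /(_ 0 ord_max).
  rewrite !mxE !eqxx mulr1 => te; move: t0; rewrite -te eqxx //.
have [l l0 eI] := inconic_bary Su ptA ptB ptC x0 y0 z0 hD hE hF iI.
have oZ : on_conic I Z.
  apply/(on_conic_bary I hZ); rewrite eI /on_conic -scalemxAr -scalemxAl.
  by rewrite (on_inconic_center x y z) scaler0.
have [cI _ _ _] := iI.
split.
- split; first by rewrite eNH conic_points_image.
  by rewrite (homology_fix dPhi e1); apply: proj_eq_refl.
- by split.
- exists (Phi^T *m I *m Phi); split=> //; first exact: conic_congr.
  exact: homology_tangent dPhi e1 oZ.
- by rewrite eNH' conic_points_image.
- exact: homology_cases dPhi e1.
Qed.
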